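(* Let $\mathcal S\colon\mathtt C\to\mathtt{FVec}$ be a stem for which $B(\mathbf 1)=\mathbb R_{\geqslant 0}$. Then for a closed convex cone $D\subseteq X$ in a finite-dimensional real vector space $X$ the following are equivalent: (i) $\overline{\mathcal G}_D$ is an $\mathcal S$-hedron. (ii) $\underline{\mathcal G}_D$ is finitely generated. (iii) $D$ is polyhedral.
   Context: All vector spaces are finite-dimensional and real; $\mathtt{FVec}$ is the category of these with linear maps, $V'=\mathrm{Lin}(V,\mathbb R)$. A cone is polyhedral if it is generated (as a convex cone) by a finite set. For a convex cone $C\subseteq V$, $C^\vee=\{\varphi\in V'\mid\varphi(x)\ge 0\ \forall x\in C\}$. For convex cones $C\subseteq V$, $D\subseteq W$: $C\mathbin{\underline{\otimes}}D=\{\sum_i c_i\otimes d_i\mid c_i\in C,d_i\in D\}\subseteq V\otimes W$ (finite sums), and $C\mathbin{\overline{\otimes}}D=(C^\vee\mathbin{\underline{\otimes}}D^\vee)^\vee$, using $V''=V$. A star autonomous category is a symmetric monoidal category $(\mathtt C,\otimes,\mathbf 1)$ with a full and faithful functor ${}^*\colon\mathtt C^{\mathrm{op}}\to\mathtt C$ and a natural bijection $\mathtt C(a\otimes b,c)\cong\mathtt C(a,(b\otimes c^* )^* )$. $\mathtt{FVec}$ is star autonomous with the usual tensor product and dual. A stem is a star autonomous functor $\mathcal S\colon\mathtt C\to\mathtt{FVec}$, where $\mathtt C$ is star autonomous: i.e. a strong monoidal functor with natural isomorphisms $\mathcal S(c^* )\cong\mathcal S(c)'$, such that $\mathcal S$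 carries the bijection $\mathtt C(a\otimes b,c)\cong\mathtt C(a,(b\otimes c^* )^* )$ to the corresponding bijection in $\mathtt{FVec}$. These isomorphisms are written as equalities: $\mathcal S(\mathbf 1)=\mathbb R$, $\mathcal S(\mathbf 1^* )=\mathbb R'=\mathbb R$, $\mathcal S(c\otimes d)=\mathcal S(c)\otimes\mathcal S(d)$, $\mathcal S(c^* )=\mathcal S(c)'$. For $c\in\mathtt C$: $A(c)=\{v\in\mathcal S(c)\mid\mathcal S(\varphi)(v)\ge 0\ \forall\varphi\in\mathtt C(c,\mathbf 1^* )\}$ and $B(c)=\overline{\mathrm{cone}}\{\mathcal S(\Phi)(1)\mid\Phi\in\mathtt C(\mathbf 1,c)\}$ (closed conic hull). An $\mathcal S$-system $\mathcal G$ on $X$ is a family of closed convex cones $\mathcal G(c)\subseteq X\otimes\mathcal S(c)$, $c\in\mathtt C$, with $(\mathrm{id}_X\otimes\mathcal S(\Phi))(\mathcal G(c))\subseteq\mathcal G(d)$ for all $\Phi\in\mathtt C(c,d)$; systems on $X$ are ordered and intersected level-wise. For a closed convex cone $D\subseteq X$, $\underline{\mathcal G}_D(c)=D\mathbin{\underline{\otimes}}B(c)$ and $\overline{\mathcal G}_D(c)=D\mathbin{\overline{\otimes}}A(c)$ define $\mathcal S$-systems on $X$. The intrinsic system $\mathcal A_d$ on $\mathcal S(d)$ is $\mathcal A_d(c)=A(d\otimes c)\subseteq\mathcal S(d)\otimes\mathcal S(c)$. A system $\mathcal G$ on $X$ has a concrete realization if there are $d\in\mathtt C$ and a linear $\Psi\colon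 X\to\mathcal S(d)$ with $\mathcal G(c)=(\Psi\otimes\mathrm{id}_{\mathcal S(c)})^{-1}(A(d\otimes c))$ for all $c$. An $\mathcal S$-hedron is a finite intersection of systems with a concrete realization. $\mathcal G$ is finitely generated if there are finitely many $a_i\in\mathcal G(c_i)$, $i=1,\dots,n$, such that $\mathcal G$ is the smallest $\mathcal S$-system containing $a_1,\dots,a_n$ (at the levels $c_1,\dots,c_n$). *)

(* Defs.v *)
From HB Require Import structures.
From mathcomp Require Import all_boot all_order all_algebra.
From mathcomp Require Import boolp classical_sets cardinality reals topology.
From mathcomp Require Import normedtype.

Set Implicit Arguments.
Unset Strict Implicit.
Unset Printing Implicit Defensive.

Import Order.TTheory GRing.Theory Num.Theory.
Import numFieldNormedType.Exports VectorInternalTheory.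

Local Open Scope classical_set_scope.
Local Open Scope ring_scope.

Declare Scope cat_scope.
Delimit Scope cat_scope with cat.

Record category := Category {
  Ob :> Type;
  hom : Ob -> Ob -> Type;
  idm : forall a, hom a a;
  compm : forall a b c, hom b c -> hom a b -> hom a c;
  compm_idl : forall a b (f : hom a b), compm (idm b) f = f;
  compm_idr : forall a b (f : hom a b), compm f (idm a) = f;
  compmA : forall a b c d (h : hom c d) (g : hom b c) (f : hom a b),
    compm h (compm g f) = compm (compm h g) f
}.

Arguments hom {_} _ _.
Arguments idm {_} a.
Arguments compm {_ a b c} _ _.

Notation "g \o f" := (compm g f) : cat_scope.

Record catiso (C : category) (a b : C) := CatIso {
  fwd :> hom a b;
  bwd : hom b a;
  fwdK : (bwd \o fwd)%cat = idm a;
  bwdK : (fwd \o bwd)%cat = idm b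
}.

Record symMonCat := SymMonCat {
  smc_cat :> category;
  tens : smc_cat -> smc_cat -> smc_cat;
  tensm : forall a a' b b' : smc_cat,
    hom a a' -> hom b b' -> hom (tens a b) (tens a' b');
  unitob : smc_cat;
  tensm_id : forall a b : smc_cat, tensm (idm a) (idm b) = idm (tens a b);
  tensm_comp : forall (a a' a'' b b' b'' : smc_cat)
    (f' : hom a' a'') (f : hom a a') (g' : hom b' b'') (g : hom b b'),
    tensm (f' \o f)%cat (g' \o g)%cat = (tensm f' g' \o tensm f g)%cat;
  assoc : forall a b c : smc_cat, catiso (tens (tens a b) c) (tens a (tens b c));
  lunit : forall a : smc_cat, catiso (tens unitob a) a;
  runit : forall a : smc_cat, catiso (tens a unitob) a;
  braid : forall a b : smc_cat, catiso (tens a b) (tens b a);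
  assoc_nat : forall (a a' b b' c c' : smc_cat)
    (f : hom a a') (g : hom b b') (h : hom c c'),
    (assoc a' b' c' \o tensm (tensm f g) h =
     tensm f (tensm g h) \o assoc a b c)%cat;
  lunit_nat : forall (a a' : smc_cat) (f : hom a a'),
    (lunit a' \o tensm (idm unitob) f = f \o lunit a)%cat;
  runit_nat : forall (a a' : smc_cat) (f : hom a a'),
    (runit a' \o tensm f (idm unitob) = f \o runit a)%cat;
  braid_nat : forall (a a' b b' : smc_cat) (f : hom a a') (g : hom b b'),
    (braid a' b' \o tensm f g = tensm g f \o braid a b)%cat;
  pentagon : forall a b c d : smc_cat,
    (assoc a b (tens c d) \o assoc (tens a b) c d =
     tensm (idm a) (assoc b c d) \o
       (assoc a (tens b c) d \o tensm (assoc a b c) (idm d)))%cat;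
  triangle : forall a b : smc_cat,
    (tensm (idm a) (lunit b) \o assoc a unitob b = tensm (runit a) (idm b))%cat;
  hexagon : forall a b c : smc_cat,
    (assoc b c a \o (braid a (tens b c) \o assoc a b c) =
     tensm (idm b) (braid a c) \o
       (assoc b a c \o tensm (braid a b) (idm c)))%cat;
  symmetry : forall a b : smc_cat,
    (braid b a \o braid a b = idm (tens a b))%cat
}.

Arguments tens {_} _ _.
Arguments tensm {_ a a' b b'} _ _.
Arguments unitob {_}.
Arguments assoc {_} a b c.
Arguments lunit {_} a.
Arguments runit {_} a.
Arguments braid {_} a b.

Record starAut := StarAut {
  sa_smc :> symMonCat;
  dual : sa_smc -> sa_smc;
  dualm : forall a b : sa_smc, hom a b -> hom (dual b) (dual a);
  dualm_id : forall a : sa_smc, dualm (idm a) = idm (dual a);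
  dualm_comp : forall (a b c : sa_smc) (g : hom b c) (f : hom a b),
    dualm (g \o f)%cat = (dualm f \o dualm g)%cat;
  dualm_faithful : forall (a b : sa_smc) (f g : hom a b),
    dualm f = dualm g -> f = g;
  dualm_full : forall (a b : sa_smc) (h : hom (dual b) (dual a)),
    exists f : hom a b, dualm f = h;
  transp : forall a b c : sa_smc,
    hom (tens a b) c -> hom a (dual (tens b (dual c)));
  transp_bij : forall a b c : sa_smc, bijective (@transp a b c);
  transp_nat1 : forall (a a' b c : sa_smc) (f : hom (tens a b) c)
    (g : hom a' a),
    transp (f \o tensm g (idm b))%cat = (transp f \o g)%cat;
  transp_nat2 : forall (a b b' c : sa_smc) (f : hom (tens a b) c)
    (g : hom b' b),
    transp (f \o tensm (idm a) g)%cat =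
    (dualm (tensm g (idm (dual c))) \o transp f)%cat;
  transp_nat3 : forall (a b c c' : sa_smc) (f : hom (tens a b) c)
    (g : hom c c'),
    transp (g \o f)%cat =
    (dualm (tensm (idm b) (dualm g)) \o transp f)%cat
}.

Arguments dual {_} _.
Arguments dualm {_ a b} _.
Arguments transp {_ a b c} _.

Record functor (C D : category) := Functor {
  fob :> C -> D;
  fmap : forall a b : C, hom a b -> hom (fob a) (fob b);
  fmap_id : forall a : C, fmap (idm a) = idm (fob a);
  fmap_comp : forall (a b c : C) (g : hom b c) (f : hom a b),
    fmap (g \o f)%cat = (fmap g \o fmap f)%cat
}.

Arguments fmap {C D} F {a b} _ : rename.

Record strongMonFunctor (C D : symMonCat) := StrongMonFunctor {
  smf_functor :> functor C D;
  mu : forall a b : C,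
    catiso (tens (smf_functor a) (smf_functor b)) (smf_functor (tens a b));
  eta : catiso unitob (smf_functor unitob);
  mu_nat : forall (a a' b b' : C) (f : hom a a') (g : hom b b'),
    (mu a' b' \o tensm (fmap smf_functor f) (fmap smf_functor g) =
     fmap smf_functor (tensm f g) \o mu a b)%cat;
  mu_assoc : forall a b c : C,
    (fmap smf_functor (assoc a b c) \o
       (mu (tens a b) c \o tensm (mu a b) (idm (smf_functor c))) =
     mu a (tens b c) \o
       (tensm (idm (smf_functor a)) (mu b c) \o
          assoc (smf_functor a) (smf_functor b) (smf_functor c)))%cat;
  mu_lunit : forall a : C,
    (fmap smf_functor (lunit a) \o
       (mu unitob a \o tensm eta (idm (smf_functor a))) =
     lunit (smf_functor a))%cat;
  mu_runit : forall a : C,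
    (fmap smf_functor (runit a) \o
       (mu a unitob \o tensm (idm (smf_functor a)) eta) =
     runit (smf_functor a))%cat
}.

Arguments mu {C D} F a b : rename.
Arguments eta {C D} F : rename.

(** The field [transp_compat] says that the functor carries the transposition
    of [C] to that of [D], modulo the identifications [mu] and [delta].
    Compatibility with the braidings is not required. *)
Record starFunctor (C D : starAut) := StarFunctor {
  sf_functor :> strongMonFunctor C D;
  delta : forall c : C, catiso (sf_functor (dual c)) (dual (sf_functor c));
  delta_nat : forall (a b : C) (f : hom a b),
    (delta a \o fmap sf_functor (dualm f) =
     dualm (fmap sf_functor f) \o delta b)%cat;
  transp_compat : forall (a b c : C) (f : hom (tens a b) c),
    (dualm (mu sf_functor b (dual c) \o
            tensm (idm (sf_functor b)) (bwd (delta c))) \o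
       (delta (tens b (dual c)) \o fmap sf_functor (transp f)) =
     transp (fmap sf_functor f \o mu sf_functor a b))%cat
}.

Arguments delta {C D} F c : rename.

Section LinearAlgebra.
Variable R : realType.
Implicit Types U V W Z : vectType R.

Definition dualv V : vectType R := 'Hom(V, R^o).

(** [V] (x) [W] is modelled by [Lin(V', W)], the pure tensor of [v] and [w]
    being [phi |-> phi v *: w]; see [tens_lift_pure] and [tens_ext] for its
    universal property. *)
Definition tensv V W : vectType R := 'Hom(dualv V, W).

Definition pure V W (v : V) (w : W) : tensv V W :=
  linfun (fun phi : dualv V => (phi v : R) *: w).

Definition dualfun V W (f : 'Hom(V, W)) : 'Hom(dualv W, dualv V) :=
  linfun (fun phi : dualv W => (phi \o f)%VF : dualv V).

Definition tensfun V V' W W' (f : 'Hom(V, V')) (g : 'Hom(W, W')) :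
    'Hom(tensv V W, tensv V' W') :=
  linfun (fun t : tensv V W => (g \o t \o dualfun f)%VF : tensv V' W').

Definition basisv V (i : 'I_(\dim {:V})) : V := (vbasis {:V})`_i.
Definition cobasisv V (i : 'I_(\dim {:V})) : dualv V :=
  linfun (coord (vbasis {:V}) i : V -> R^o).

(** Meaningful for bilinear [B] only, where it does not depend on the basis:
    see [tens_lift_pure]. *)
Definition tens_lift V W Z (B : V -> W -> Z) : 'Hom(tensv V W, Z) :=
  linfun (fun t : tensv V W => \sum_i B (basisv i) (t (cobasisv i))).

Definition bilin V W Z (B : V -> W -> Z) : Prop :=
  (forall v, linear (B v)) /\ (forall w, linear (B^~ w)).

Lemma linfunE V W (f : V -> W) : linear f -> linfun f =1 f.
Proof.
move=> lf x; pose aux := GRing.isLinear.Build R V W _ f lf.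
pose g : {linear V -> W} := HB.pack f aux.
exact: (lfunE g x).
Qed.

Lemma linearD V W (f : V -> W) : linear f -> forall x y, f (x + y) = f x + f y.
Proof. by move=> lf x y; rewrite -[x]scale1r lf !scale1r. Qed.

Lemma linear_0 V W (f : V -> W) : linear f -> f 0 = 0.
Proof.
by move=> lf; apply: (@addrI _ (f 0)); rewrite -(linearD lf) !addr0.
Qed.

Lemma linear_Z V W (f : V -> W) : linear f -> forall k x, f (k *: x) = k *: f x.
Proof. by move=> lf k x; rewrite -[k *: x]addr0 lf (linear_0 lf) addr0. Qed.

Lemma linear_sumE V W (f : V -> W) : linear f ->
  forall n (F : 'I_n -> V), f (\sum_i F i) = \sum_i f (F i).
Proof.
move=> lf n F; apply: (big_morph f); last exact: linear_0.
exact: linearD.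
Qed.

Lemma lfun_linear V W (f : 'Hom(V, W)) : linear f.
Proof. exact: linearP. Qed.

Lemma linfun_linear V W (f : V -> W) : linear (linfun f).
Proof. exact: linearP. Qed.

Lemma addvE V W (f g : 'Hom(V, W)) v : (f + g) v = f v + g v.
Proof. exact: lfunE. Qed.

Lemma scalevE V W k (f : 'Hom(V, W)) v : (k *: f) v = k *: f v.
Proof. exact: lfunE. Qed.

Lemma linear_pw V W Z (F : V -> 'Hom(W, Z)) :
  (forall w, linear (fun v => F v w)) -> linear F.
Proof.
by move=> h k x y; apply/lfunP => w; rewrite addvE scalevE; exact: h.
Qed.

Lemma basisv_sum V (v : V) :
  v = \sum_i (cobasisv i v : R) *: (basisv i : V).
Proof.
rewrite [LHS](coord_vbasis (memvf v)); apply: eq_bigr => i _.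
by congr (_ *: _); rewrite linfunE //; exact: linearP.
Qed.

Lemma dual_sum V (phi : dualv V) :
  phi = \sum_i (phi (basisv i) : R) *: (cobasisv i : dualv V).
Proof.
apply/lfunP => v; rewrite {1}(basisv_sum v) (linear_sumE (lfun_linear phi)).
rewrite sum_lfunE; apply: eq_bigr => i _.
by rewrite scalevE (linear_Z (lfun_linear phi)) [LHS]mulrC.
Qed.

Lemma pureE V W (v : V) (w : W) phi : pure v w phi = (phi v : R) *: w.
Proof.
rewrite linfunE // => k x y.
by rewrite addvE scalevE scalerDl scalerA.
Qed.

Lemma pure_bilin V W : bilin (@pure V W).
Proof.
split=> [v|w]; apply: linear_pw => phi k x y; rewrite !pureE.
  by rewrite scalerDr !scalerA mulrC.
by rewrite lfun_linear scalerDl scalerA.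
Qed.

Lemma dualfunE V W (f : 'Hom(V, W)) phi v : dualfun f phi v = phi (f v).
Proof.
rewrite linfunE ?comp_lfunE //; apply: linear_pw => x k a b.
by rewrite !comp_lfunE addvE scalevE.
Qed.

Lemma tensfunE V V' W W' (f : 'Hom(V, V')) (g : 'Hom(W, W')) t phi :
  tensfun f g t phi = g (t (dualfun f phi)).
Proof.
rewrite linfunE ?comp_lfunE //; apply: linear_pw => x k a b.
by rewrite !comp_lfunE addvE scalevE lfun_linear.
Qed.

Lemma tensfun_pure V V' W W' (f : 'Hom(V, V')) (g : 'Hom(W, W')) v w :
  tensfun f g (pure v w) = pure (f v) (g w).
Proof.
apply/lfunP => phi; rewrite tensfunE !pureE dualfunE.
by rewrite (linear_Z (lfun_linear g)).
Qed.

Lemma tens_liftE V W Z (B : V -> W -> Z) t : (forall v, linear (B v)) ->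
  tens_lift B t = \sum_i B (basisv i) (t (cobasisv i)).
Proof.
move=> lB; rewrite linfunE // => k x y.
rewrite scaler_sumr -big_split; apply: eq_bigr => i _ /=.
by rewrite addvE scalevE lB.
Qed.

Lemma tens_lift_pure V W Z (B : V -> W -> Z) v w : bilin B ->
  tens_lift B (pure v w) = B v w.
Proof.
move=> [lB rB]; rewrite tens_liftE // {2}(basisv_sum v).
rewrite (linear_sumE (rB w)); apply: eq_bigr => i _.
by rewrite pureE (linear_Z (lB _)) (linear_Z (rB w)).
Qed.

Lemma tens_sum V W (t : tensv V W) :
  t = \sum_i pure (basisv i) (t (cobasisv i)).
Proof.
apply/lfunP => phi; rewrite {1}(dual_sum phi) (linear_sumE (lfun_linear t)).
rewrite sum_lfunE; apply: eq_bigr => i _.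
by rewrite pureE (linear_Z (lfun_linear t)).
Qed.

Lemma tens_ext V W Z (f g : 'Hom(tensv V W, Z)) :
  (forall v w, f (pure v w) = g (pure v w)) -> f = g.
Proof.
move=> fg; apply/lfunP => t; rewrite (tens_sum t).
rewrite (linear_sumE (lfun_linear f)) (linear_sumE (lfun_linear g)).
by apply: eq_bigr => i _; exact: fg.
Qed.

Lemma linear_comp V W Z (f : W -> Z) (g : V -> W) :
  linear f -> linear g -> linear (fun v => f (g v)).
Proof. by move=> lf lg k x y; rewrite lg lf. Qed.

Lemma tens_lift_linear_fun U V W Z (B : U -> V -> W -> Z) t :
  (forall u v, linear (B u v)) -> (forall v w, linear (fun u => B u v w)) ->
  linear (fun u => tens_lift (B u) t).
Proof.
move=> l3 l1 k x y; rewrite !tens_liftE // scaler_sumr -big_split /=.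
by apply: eq_bigr => i _; rewrite l1.
Qed.

Definition lfun_ev V (v : V) : dualv (dualv V) :=
  linfun (fun phi : dualv V => phi v).

Definition lfun_unev V (x : dualv (dualv V)) : V :=
  \sum_i (x (cobasisv i) : R) *: basisv i.

Lemma lfun_evE V (v : V) phi : lfun_ev v phi = phi v.
Proof. by rewrite linfunE // => k x y; rewrite addvE scalevE. Qed.

Lemma lfun_unev_dual V (x : dualv (dualv V)) (phi : dualv V) :
  phi (lfun_unev x) = x phi.
Proof.
rewrite (linear_sumE (lfun_linear phi)) [in RHS](dual_sum phi).
rewrite (linear_sumE (lfun_linear x)); apply: eq_bigr => i _.
by rewrite (linear_Z (lfun_linear phi)) (linear_Z (lfun_linear x)) [LHS]mulrC.
Qed.

Lemma dualv_sep V (v w : V) : (forall phi : dualv V, phi v = phi w) -> v = w.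
Proof.
move=> h; rewrite (basisv_sum v) (basisv_sum w).
by apply: eq_bigr => i _; rewrite h.
Qed.

Definition tassoc U V W :
    'Hom(tensv (tensv U V) W, tensv U (tensv V W)) :=
  tens_lift (fun t w => tens_lift (fun u v => pure u (pure v w)) t).
Definition tassoc_inv U V W :
    'Hom(tensv U (tensv V W), tensv (tensv U V) W) :=
  tens_lift (fun u t => tens_lift (fun v w => pure (pure u v) w) t).
Definition tlunit V : 'Hom(tensv R^o V, V) :=
  tens_lift (fun (r : R^o) (v : V) => (r : R) *: v).
Definition tlunit_inv V : 'Hom(V, tensv R^o V) :=
  linfun (fun v => pure (1 : R^o) v).
Definition trunit V : 'Hom(tensv V R^o, V) :=
  tens_lift (fun (v : V) (r : R^o) => (r : R) *: v).
Definition trunit_inv V : 'Hom(V, tensv V R^o) :=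
  linfun (fun v => pure v (1 : R^o)).
Definition tbraid V W : 'Hom(tensv V W, tensv W V) :=
  tens_lift (fun v w => pure w v).

Lemma pure_linl V W (w : W) : linear (fun v : V => pure v w).
Proof. exact: (pure_bilin V W).2. Qed.

Lemma pure_linr V W (v : V) : linear (fun w : W => pure v w).
Proof. exact: (pure_bilin V W).1. Qed.

Lemma tassoc_pure U V W (u : U) (v : V) (w : W) :
  tassoc U V W (pure (pure u v) w) = pure u (pure v w).
Proof.
have b w0 : bilin (fun (u : U) (v : V) => pure u (pure v w0)).
  split=> [u0|v0]; last exact: pure_linl.
  exact: (linear_comp (pure_linr u0) (pure_linl w0)).
rewrite tens_lift_pure ?tens_lift_pure //; split=> [t|w0]; last exact: lfun_linear.
apply: (@tens_lift_linear_fun W U V _ (fun w u v => pure u (pure v w))) => [w0 u0|u0 v0].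
  exact: (linear_comp (pure_linr u0) (pure_linl w0)).
exact: (linear_comp (pure_linr u0) (pure_linr v0)).
Qed.

Lemma tassoc_inv_pure U V W (u : U) (v : V) (w : W) :
  tassoc_inv U V W (pure u (pure v w)) = pure (pure u v) w.
Proof.
have b u0 : bilin (fun (v : V) (w : W) => pure (pure u0 v) w).
  split=> [v0|w0]; first exact: pure_linr.
  exact: (linear_comp (pure_linl w0) (pure_linr u0)).
rewrite tens_lift_pure ?tens_lift_pure //; split=> [u0|t]; first exact: lfun_linear.
apply: (@tens_lift_linear_fun U V W _ (fun u v w => pure (pure u v) w)) => [u0 v0|v0 w0].
  exact: pure_linr.
exact: (linear_comp (pure_linl w0) (pure_linl v0)).
Qed.

Lemma tlunit_pure V (r : R^o) (v : V) : tlunit V (pure r v) = (r : R) *: v.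
Proof.
rewrite tens_lift_pure //; split=> [s|w] k x y.
  by rewrite scalerDr !scalerA mulrC.
by rewrite scalerDl scalerA.
Qed.

Lemma trunit_pure V (v : V) (r : R^o) : trunit V (pure v r) = (r : R) *: v.
Proof.
rewrite tens_lift_pure //; split=> [s|w] k x y.
  by rewrite scalerDl scalerA.
by rewrite scalerDr !scalerA mulrC.
Qed.

Lemma tlunit_invE V (v : V) : tlunit_inv V v = pure (1 : R^o) v.
Proof. by rewrite linfunE //; exact: pure_linr. Qed.

Lemma trunit_invE V (v : V) : trunit_inv V v = pure v (1 : R^o).
Proof. by rewrite linfunE //; exact: pure_linl. Qed.

Lemma tbraid_pure V W (v : V) (w : W) : tbraid V W (pure v w) = pure w v.
Proof.
rewrite tens_lift_pure //; split=> [v0|w0]; first exact: pure_linl.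
exact: pure_linr.
Qed.

(** The transposition [Lin(V (x) W, Z) -> Lin(V, (W (x) Z')')]. *)
Definition ttransp_body V W Z (f : 'Hom(tensv V W, Z)) (v : V) :
    dualv (tensv W (dualv Z)) :=
  tens_lift (fun (w : W) (zeta : dualv Z) => zeta (f (pure v w))).
Definition ttransp V W Z (f : 'Hom(tensv V W, Z)) :
    'Hom(V, dualv (tensv W (dualv Z))) := linfun (ttransp_body f).

Definition tuntransp V W Z (h : 'Hom(V, dualv (tensv W (dualv Z)))) :
    'Hom(tensv V W, Z) :=
  tens_lift (fun v w =>
    lfun_unev (linfun (fun zeta : dualv Z => h v (pure w zeta)))).

Lemma ttransp_pure V W Z (f : 'Hom(tensv V W, Z)) v w zeta :
  ttransp f v (pure w zeta) = zeta (f (pure v w)).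
Proof.
have lin_dual (zeta' : dualv Z) : linear (fun w' : W => zeta' (f (pure v w'))).
  apply: (linear_comp (lfun_linear zeta')).
  exact: (linear_comp (lfun_linear f) (pure_linr v)).
rewrite linfunE; last first.
  apply: linear_pw => t.
  apply: (@tens_lift_linear_fun V W (dualv Z) R^o
    (fun v w zeta => zeta (f (pure v w)))) => [v' w' k x y|w' zeta'].
    by rewrite addvE scalevE.
  apply: (linear_comp (lfun_linear zeta')).
  exact: (linear_comp (lfun_linear f) (pure_linl w')).
rewrite tens_lift_pure //; split=> [w' k x y|//].
by rewrite addvE scalevE.
Qed.

Lemma tuntransp_pure V W Z (h : 'Hom(V, dualv (tensv W (dualv Z)))) v w
    (zeta : dualv Z) :
  zeta (tuntransp h (pure v w)) = h v (pure w zeta).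
Proof.
have key v' w' : linear (fun zeta : dualv Z => h v' (pure w' zeta)).
  exact: (linear_comp (lfun_linear (h v')) (pure_linr w')).
rewrite tens_lift_pure ?lfun_unev_dual ?linfunE //.
split=> [v'|w'] k x y; apply: dualv_sep => phi;
  rewrite (lfun_linear phi) !lfun_unev_dual !linfunE //.
  exact: (linear_comp (lfun_linear (h v')) (pure_linl phi)).
by rewrite (lfun_linear h k x y) addvE scalevE.
Qed.

Lemma ttransp_bij V W Z : bijective (@ttransp V W Z).
Proof.
exists (@tuntransp V W Z) => [f|h].
  apply: tens_ext => v w; apply: dualv_sep => zeta.
  by rewrite tuntransp_pure ttransp_pure.
apply/lfunP => v; apply: tens_ext => w zeta.
by rewrite ttransp_pure tuntransp_pure.
Qed.

Lemma dualfun_inj V W : injective (@dualfun V W).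
Proof.
move=> f g fg; apply/lfunP => v; apply: dualv_sep => phi.
by rewrite -!dualfunE fg.
Qed.

Lemma dualfun_full V W (h : 'Hom(dualv W, dualv V)) :
  exists f : 'Hom(V, W), dualfun f = h.
Proof.
have lh v : linear (fun phi : dualv W => h phi v).
  by move=> k x y; rewrite (lfun_linear h) addvE scalevE.
exists (linfun (fun v => lfun_unev (linfun (fun phi : dualv W => h phi v)))).
apply/lfunP => phi; apply/lfunP => v; rewrite dualfunE linfunE.
  by rewrite lfun_unev_dual linfunE.
move=> k x y; apply: dualv_sep => psi; rewrite (lfun_linear psi) !lfun_unev_dual.
by rewrite !linfunE // lfun_linear.
Qed.

Definition FVec_cat : category.
Proof.
refine (@Category (vectType R) (fun V W => 'Hom(V, W)) (fun V => \1%VF)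
  (fun V W Z g f => (g \o f)%VF) _ _ _).
- by move=> V W f; exact: comp_lfun1l.
- by move=> V W f; exact: comp_lfun1r.
- by move=> V W Z T h g f; exact: comp_lfunA.
Defined.

Lemma tassocK U V W : (tassoc_inv U V W \o tassoc U V W)%VF = \1%VF.
Proof.
apply: tens_ext => t w; rewrite (tens_sum t).
rewrite (linear_sumE (pure_linl w)) !(linear_sumE (lfun_linear _)).
by apply: eq_bigr => i _; rewrite comp_lfunE id_lfunE tassoc_pure tassoc_inv_pure.
Qed.

Lemma tassoc_invK U V W : (tassoc U V W \o tassoc_inv U V W)%VF = \1%VF.
Proof.
apply: tens_ext => u t; rewrite (tens_sum t).
rewrite (linear_sumE (pure_linr u)) !(linear_sumE (lfun_linear _)).
by apply: eq_bigr => i _; rewrite comp_lfunE id_lfunE tassoc_inv_pure tassoc_pure.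
Qed.

Lemma tens_ext3 U V W Z (f g : 'Hom(tensv (tensv U V) W, Z)) :
  (forall u v w, f (pure (pure u v) w) = g (pure (pure u v) w)) -> f = g.
Proof.
move=> fg; apply: tens_ext => t w; rewrite (tens_sum t).
rewrite (linear_sumE (pure_linl w)) !(linear_sumE (lfun_linear _)).
by apply: eq_bigr => i _; exact: fg.
Qed.

Lemma tens_ext4 U V W T Z (f g : 'Hom(tensv (tensv (tensv U V) W) T, Z)) :
  (forall u v w x, f (pure (pure (pure u v) w) x) =
                   g (pure (pure (pure u v) w) x)) -> f = g.
Proof.
move=> fg; apply: tens_ext3 => t w x; rewrite (tens_sum t).
rewrite (linear_sumE (linear_comp (pure_linl x) (pure_linl w))).
rewrite !(linear_sumE (lfun_linear _)).
by apply: eq_bigr => i _; exact: fg.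
Qed.

Lemma tlunitK V : (tlunit_inv V \o tlunit V)%VF = \1%VF.
Proof.
apply: tens_ext => r v; rewrite comp_lfunE id_lfunE tlunit_pure tlunit_invE.
by rewrite (linear_Z (pure_linr _)) -(linear_Z (pure_linl _)) [_ *: _]mulr1.
Qed.

Lemma tlunit_invK V : (tlunit V \o tlunit_inv V)%VF = \1%VF.
Proof.
by apply/lfunP => v; rewrite comp_lfunE id_lfunE tlunit_invE tlunit_pure scale1r.
Qed.

Lemma trunitK V : (trunit_inv V \o trunit V)%VF = \1%VF.
Proof.
apply: tens_ext => v r; rewrite comp_lfunE id_lfunE trunit_pure trunit_invE.
by rewrite (linear_Z (pure_linl _)) -(linear_Z (pure_linr _)) [_ *: _]mulr1.
Qed.

Lemma trunit_invK V : (trunit V \o trunit_inv V)%VF = \1%VF.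
Proof.
by apply/lfunP => v; rewrite comp_lfunE id_lfunE trunit_invE trunit_pure scale1r.
Qed.

Lemma tbraidK V W : (tbraid W V \o tbraid V W)%VF = \1%VF.
Proof.
by apply: tens_ext => v w; rewrite comp_lfunE id_lfunE !tbraid_pure.
Qed.

Definition tpureE := (comp_lfunE, id_lfunE, tensfun_pure, tassoc_pure,
  tlunit_pure, trunit_pure, tbraid_pure).

Definition FVec_smc : symMonCat.
Proof.
refine (@SymMonCat FVec_cat tensv tensfun R^o _ _
  (fun U V W => @CatIso FVec_cat _ _ (tassoc U V W) (tassoc_inv U V W)
     (tassocK U V W) (tassoc_invK U V W))
  (fun V => @CatIso FVec_cat _ _ (tlunit V) (tlunit_inv V)
     (tlunitK V) (tlunit_invK V))
  (fun V => @CatIso FVec_cat _ _ (trunit V) (trunit_inv V)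
     (trunitK V) (trunit_invK V))
  (fun V W => @CatIso FVec_cat _ _ (tbraid V W) (tbraid W V)
     (tbraidK V W) (tbraidK W V))
  _ _ _ _ _ _ _ _) => /=.
- by move=> V W; apply: tens_ext => v w; rewrite !tpureE.
- by move=> *; apply: tens_ext => v w; rewrite !tpureE.
- by move=> *; apply: tens_ext3 => u v w; rewrite !tpureE.
- by move=> *; apply: tens_ext => r v; rewrite !tpureE linearZ.
- by move=> *; apply: tens_ext => r v; rewrite !tpureE linearZ.
- by move=> *; apply: tens_ext => v w; rewrite !tpureE.
- by move=> *; apply: tens_ext4 => u v w x; rewrite !tpureE.
- move=> *; apply: tens_ext3 => v r w; rewrite !tpureE.
  by rewrite (linear_Z (pure_linr _)) (linear_Z (pure_linl _)).
- by move=> *; apply: tens_ext3 => u v w; rewrite !tpureE.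
- by move=> *; exact: tbraidK.
Defined.

Definition FVec : starAut.
Proof.
refine (@StarAut FVec_smc dualv dualfun _ _ _ _ ttransp ttransp_bij _ _ _) => /=.
- move=> V; apply/lfunP => phi; apply/lfunP => v.
  by rewrite dualfunE !id_lfunE.
- move=> U V W g f; apply/lfunP => phi; apply/lfunP => v.
  by rewrite comp_lfunE !dualfunE comp_lfunE.
- exact: dualfun_inj.
- exact: dualfun_full.
- move=> V V' W Z f g; apply/lfunP => v; apply: tens_ext => w zeta.
  by rewrite comp_lfunE !ttransp_pure comp_lfunE tensfun_pure id_lfunE.
- move=> V W W' Z f g; apply/lfunP => v; apply: tens_ext => w zeta.
  rewrite comp_lfunE dualfunE tensfun_pure !ttransp_pure comp_lfunE.
  by rewrite tensfun_pure !id_lfunE.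
- move=> V W Z Z' f g; apply/lfunP => v; apply: tens_ext => w zeta.
  rewrite comp_lfunE dualfunE tensfun_pure !ttransp_pure comp_lfunE.
  by rewrite id_lfunE dualfunE.
Defined.

(** The canonical isomorphism [V (x) W -> (V' (x) W')']. *)
Definition tens_canon V W :
    'Hom(tensv V W, dualv (tensv (dualv V) (dualv W))) :=
  tens_lift (fun v w =>
    tens_lift (fun (phi : dualv V) (psi : dualv W) => (phi v * psi w : R^o))).

Lemma tens_canon_pure V W (v : V) (w : W) (phi : dualv V) (psi : dualv W) :
  tens_canon V W (pure v w) (pure phi psi) = phi v * psi w.
Proof.
have b v' w' : bilin (fun (phi : dualv V) (psi : dualv W) =>
    (phi v' * psi w' : R^o)).
  split=> [p|p] k x y /=; rewrite addvE scalevE.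
    by rewrite mulrDr mulrCA.
  by rewrite mulrDl -mulrA.
rewrite tens_lift_pure ?tens_lift_pure //; split=> [v'|w'];
  move=> k x y; apply: tens_ext => p q;
  rewrite addvE scalevE !tens_lift_pure // (lfun_linear _ k x y).
  by rewrite mulrDr mulrCA.
by rewrite mulrDl -mulrA.
Qed.

(** Convex cones are nonempty, so that the empty set generates [{0}]. *)
Definition convex_cone V (C : set V) : Prop :=
  [/\ C 0, forall x y, C x -> C y -> C (x + y) &
      forall (k : R) x, 0 <= k -> C x -> C (k *: x)].

(** The topology of a finite-dimensional space, transported from ['rV_n] along
    the coordinate isomorphism [v2r] (any linear isomorphism gives the same). *)
Definition vclosed V (C : set V) : Prop :=
  closed [set r : 'rV[R]_(dim V) | C (r2v r)].
Definition vclosure V (C : set V) : set V :=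
  [set v | closure [set r : 'rV[R]_(dim V) | C (r2v r)] (v2r v)].

Definition closed_convex_cone V (C : set V) : Prop :=
  convex_cone C /\ vclosed C.

Definition cone_hull V (A : set V) : set V := smallest (@convex_cone V) A.
Definition closed_cone_hull V (A : set V) : set V := vclosure (cone_hull A).

Definition polyhedral V (C : set V) : Prop :=
  exists2 A : set V, finite_set A & C = cone_hull A.

Definition dual_cone V (C : set V) : set (dualv V) :=
  [set phi : dualv V | forall x, C x -> 0 <= (phi x : R)].

Definition min_tens V W (C : set V) (D : set W) : set (tensv V W) :=
  [set t | exists (n : nat) (c : 'I_n -> V) (d : 'I_n -> W),
     [/\ forall i, C (c i), forall i, D (d i) & t = \sum_i pure (c i) (d i)]].

Definition max_tens V W (C : set V) (D : set W) : set (tensv V W) :=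
  tens_canon V W @^-1` dual_cone (min_tens (dual_cone C) (dual_cone D)).

End LinearAlgebra.

Definition stem (R : realType) (C : starAut) := starFunctor C (FVec R).

Section Systems.
Variables (R : realType) (C : starAut) (S : stem R C).
Implicit Types (X : vectType R) (c d : C).

Definition sob c : vectType R := fob S c.
Definition smap c d (f : hom c d) : 'Hom(sob c, sob d) := fmap S f.

(** The identifications [S (a (x) b) = S a (x) S b], [S 1 = R] and
    [S 1^* = R' = R]. *)
Definition smu a b : 'Hom(tensv (sob a) (sob b), sob (tens a b)) := fwd (mu S a b).
Definition seta : 'Hom(R^o, sob unitob) := fwd (eta S).
Definition sdelta c : 'Hom(sob (dual c), dualv (sob c)) := fwd (delta S c).
Definition sval_unit_dual (v : sob (dual unitob)) : R :=
  sdelta unitob v (seta 1).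

Definition Acone c : set (sob c) :=
  [set v | forall phi : hom c (dual unitob), 0 <= sval_unit_dual (smap phi v)].

Definition Bcone c : set (sob c) :=
  closed_cone_hull [set smap Phi (seta 1) | Phi in [set: hom unitob c]].

Definition family X := forall c, set (tensv X (sob c)).

Definition is_system X (G : family X) : Prop :=
  (forall c, closed_convex_cone (G c)) /\
  (forall c d (Phi : hom c d),
     tensfun \1%VF (smap Phi) @` G c `<=` G d).

Definition min_system X (D : set X) : family X :=
  fun c => min_tens D (@Bcone c).
Definition max_system X (D : set X) : family X :=
  fun c => max_tens D (@Acone c).

Definition intrinsic d : family (sob d) :=
  fun c => smu d c @^-1` @Acone (tens d c).

Arguments intrinsic : clear implicits.

Definition has_concrete_realization X (G : family X) : Prop :=
  exists (d : C) (Psi : 'Hom(X, sob d)),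
    forall c, G c = tensfun Psi \1%VF @^-1` intrinsic d c.

Definition is_hedron X (G : family X) : Prop :=
  exists (n : nat) (H : 'I_n -> family X),
    (forall i, is_system (H i) /\ has_concrete_realization (H i)) /\
    (forall c, G c = \bigcap_i H i c).

Definition finitely_generated X (G : family X) : Prop :=
  exists (n : nat) (c : 'I_n -> C) (a : forall i, tensv X (sob (c i))),
    [/\ is_system G, forall i, G (c i) (a i) &
        forall H : family X, is_system H -> (forall i, H (c i) (a i)) ->
          forall e, G e `<=` H e].

End Systems.

Arguments sob {R C} S c.
Arguments Acone {R C} S c.
Arguments Bcone {R C} S c.
Arguments seta {R C} S.
Arguments min_system {R C} S {X} D.
Arguments max_system {R C} S {X} D.

(* Main.v *)
Require Import Defs.
From HB Require Import structures.
From mathcomp Require Import all_boot all_order all_algebra.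
From mathcomp Require Import boolp classical_sets cardinality reals topology.
From mathcomp Require Import normedtype.
From mathcomp Require Import derive ring lra.
Import Order.TTheory GRing.Theory Num.Theory.
Local Open Scope classical_set_scope.
Local Open Scope ring_scope.

(** The smallest and the largest system over [D] determine [D]: by the hypothesis
    on [B], the cones [B(1)] and [A 1^*] are half-lines, so that [D] can be read
    off from the pure tensors at the level of the unit, resp. of its dual
    ([Bcone_unit], [dual_unit_ray]). Hence, to see that [D] is polyhedral, it is
    enough to find a polyhedral cone with the same system.

    If [D] is generated by finitely many [v], the tensors [v (x) 1] generate the
    smallest system ([polyhedral_finitely_generated]); if [D] is cut out by
    finitely many linear forms, each of them gives a concrete realization
    through the unit object, and their intersection is the largest system
    ([polyhedral_hedron]). By the Minkowski-Weyl theorem ([polyhedral_hcone]),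
    obtained from Fourier-Motzkin elimination and the bipolar theorem, the two
    descriptions of polyhedral cones agree.

    Conversely, finitely many generators of the smallest system involve only
    finitely many elements of [D], and the cone that these generate already has
    the same smallest system ([finitely_generated_polyhedral]). Dually, a concrete
    realization through [S d] amounts to one linear form on [X (x) S e] for a suitable
    object [e], because the morphisms [d (x) c -> 1^*] all factor through a universal
    one ([pairing_universal]). This form is nonnegative on [D] tensored
    maximally with [A(e)], hence belongs to the minimal tensor product of the dual
    cones and involves finitely many elements of the dual of [D]
    ([realization_bound]); these cut out a polyhedral cone with the same largest
    system ([hedron_polyhedral]).

    The analytic core is that the minimal tensor product of two closed convex
    cones is closed ([min_tens_closed]), even if they contain lines. It makes
    the smallest systems systems, and it turns the form above into a finite sum
    of products rather than a limit of such sums. *)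

Import numFieldNormedType.Exports VectorInternalTheory.

Set Implicit Arguments.
Unset Strict Implicit.
Unset Printing Implicit Defensive.

(** * Closed cones in coordinates *)

Lemma mx_continuous (T : topologicalType) (R : realType) n (f : T -> 'rV[R]_n) :
  (forall i, continuous (fun x => f x ord0 i)) -> continuous f.
Proof.
move=> cf x A [P Pf sPA].
have : \forall y \near x, forall i, P ord0 i (f y ord0 i).
  by apply: filter_forall => i; exact: cf.
by apply: filterS => y Py; apply: sPA => i j; rewrite ord1.
Qed.

(** Images of closed cones under continuous maps need not be closed. They are
    when [g] is homogeneous and vanishes on [K] at the origin only: by
    compactness [`|g|] is bounded below on the unit sphere of [K], so that
    [`|g x|] controls [`|x|] and, locally, only the part of [K] in a large ball
    (a compact set) contributes to the image. *)
Lemma closed_image_homogeneous (R : realType) m n p (K : set 'rV[R]_m)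
    (g : 'rV[R]_m -> 'rV[R]_n) :
  closed K -> continuous g ->
  (forall (k : R) x, 0 <= k -> K x -> K (k *: x)) ->
  (forall (k : R) x, 0 <= k -> g (k *: x) = k ^+ p.+1 *: g x) ->
  (forall x, K x -> g x = 0 -> x = 0) -> closed (g @` K).
Proof.
move=> clK cg scK hg g0.
have cnorm k : continuous (fun x : 'rV[R]_k => `|x|).
  by move=> x; exact: norm_continuous.
have [d d0 dle] : exists2 d : R, 0 < d &
    forall x, K x -> d * `|x| ^+ p.+1 <= `|g x|.
  pose S := K `&` [set x : 'rV[R]_m | `|x| = 1].
  have toS x : K x -> x != 0 -> S (`|x|^-1 *: x).
    move=> Kx x0; split; first by apply: scK => //; rewrite invr_ge0.
    by rewrite /= normrZ normfV normr_id mulVf // normr_eq0.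
  have [[s0 Ss0]|noS] := pselect (S !=set0); last first.
    exists 1 => // x Kx; have [->|x0] := eqVneq x 0.
      by rewrite normr0 expr0n mulr0.
    by exfalso; apply: noS; exists (`|x|^-1 *: x); exact: toS.
  have cS : compact S.
    apply: bounded_closed_compact.
      exists 1; split=> // M M1 x [_ /= ->]; exact: ltW.
    apply: closedI => //.
    have /continuous_closedP /(_ [set r | r = 1]) := cnorm m.
    by apply; exact: closed_eq.
  have [c /set_mem [Kc nc] cmin] := @compact_EVT_min _ R (fun x => `|g x|) S
    (ex_intro _ s0 Ss0) cS
    (continuous_subspaceT (fun x => cvg_norm (cg x))).
  exists `|g c|.
    rewrite normr_gt0; apply/eqP => gc0; move: nc.
    by rewrite /= (g0 _ Kc gc0) normr0 => /eqP; rewrite eq_sym oner_eq0.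
  move=> x Kx; have [->|x0] := eqVneq x 0.
    by rewrite normr0 expr0n mulr0.
  have nx : `|x| != 0 by rewrite normr_eq0.
  have := cmin _ (mem_set (toS x Kx x0)).
  rewrite hg ?invr_ge0 // normrZ ger0_norm ?exprn_ge0 ?invr_ge0 //.
  by rewrite exprVn ler_pdivlMl ?exprn_gt0 ?normr_gt0 // mulrC.
move=> y cly.
(* The points of [K] mapped into the unit ball around [y] have norm at most [M];
   the maximum with [1] allows [`|x| <= `|x| ^+ p.+1] to be used. *)
pose M := Num.max 1 (d^-1 * (`|y| + 1)).
pose Kb := K `&` [set x : 'rV[R]_m | `|x| <= M].
have cKb : compact Kb.
  apply: bounded_closed_compact.
    exists M; split; first exact: num_real.
    move=> N MN x [_ /= xM]; exact: le_trans xM (ltW MN).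
  apply: closedI => //.
  have /continuous_closedP /(_ [set r | r <= M]) := cnorm m.
  by apply; exact: closed_le.
have /compact_closed clb : compact (g @` Kb).
  by apply: continuous_compact => //; exact: continuous_subspaceT.
suff : closure (g @` Kb) y.
  by move=> /(clb (@norm_hausdorff _ _)) [x [Kx _] <-]; exists x.
move=> B By.
have : nbhs y (B `&` ball y 1) by apply: filterI => //; exact: nbhsx_ballx.
move=> /cly [_ [[x Kx <-] [Bx]]].
rewrite -ball_normE /ball_ /= => xy1.
exists (g x); split=> //; exists x => //; split=> //=.
have gx : `|g x| <= `|y| + 1.
  rewrite -[g x](subrK y) (le_trans (ler_normD _ _)) // addrC lerD2l.
  by rewrite distrC ltW.
rewrite le_max; have [//|x1] := leP `|x| 1.
apply: (@le_trans _ _ (`|x| ^+ p.+1)); first by rewrite ler_eXnr // ltW.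
rewrite -ler_pdivrMl ?invr_gt0 // invrK.
exact: le_trans (dle _ Kx) gx.
Qed.

Section VectorTopology.
Variable R : realType.
Implicit Types U V W : vectType R.

(** Continuity for the topology that [vclosed] refers to. *)
Definition vcont U (g : U -> R) : Prop :=
  continuous (fun r : 'rV[R]_(dim U) => g (r2v r)).

Lemma vcont_ext U (g h : U -> R) : g =1 h -> vcont g -> vcont h.
Proof. by move=> /funext ->. Qed.

Lemma vcont_cst U (a : R) : vcont (fun _ : U => a).
Proof. exact: cst_continuous. Qed.

Lemma vcontD U (g h : U -> R) :
  vcont g -> vcont h -> vcont (fun u => g u + h u).
Proof. move=> cg ch x; exact: (cvgD (cg x) (ch x)). Qed.

Lemma vcontM U (g h : U -> R) :
  vcont g -> vcont h -> vcont (fun u => g u * h u).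
Proof. move=> cg ch x; exact: (cvgM (cg x) (ch x)). Qed.

Lemma vcont_sum U (I : Type) (s : seq I) (g : I -> U -> R) :
  (forall i, vcont (g i)) -> vcont (fun u => \sum_(i <- s) g i u).
Proof.
move=> cg; apply: continuous_big => [x|i _]; last exact: cg.
exact: add_continuous.
Qed.

Lemma vcont_lin U (phi : dualv U) : vcont phi.
Proof.
have -> : (phi : U -> R) =
    fun u => \sum_i (v2r u ord0 i * phi (r2v (delta_mx ord0 i))).
  apply/funext => u; rewrite -{1}[u]v2rK {1}(row_sum_delta (v2r u)).
  by rewrite !linear_sum; apply: eq_bigr => i _; rewrite !linearZ.
apply: vcont_sum => i; apply: vcontM; last exact: vcont_cst.
move=> x; under eq_fun do rewrite r2vK; exact: coord_continuous.
Qed.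
Arguments vcont_lin {U} phi.

(** In finite dimension, continuity into [W] can be tested on linear forms. *)
Definition vcontmap U W (f : U -> W) : Prop :=
  forall phi : dualv W, vcont (fun u => phi (f u) : R).

Definition vcoord W (i : 'I_(dim W)) : dualv W :=
  linfun (fun w => v2r w ord0 i : R^o).

Lemma vcoordE W i (w : W) : vcoord i w = v2r w ord0 i.
Proof. by rewrite linfunE // => k x y; rewrite linearP !mxE. Qed.

Lemma vcontmap_continuous U W (f : U -> W) : vcontmap f ->
  continuous (fun r : 'rV[R]_(dim U) => v2r (f (r2v r))).
Proof.
move=> cf; apply: mx_continuous => i.
apply: (@vcont_ext _ _ (fun u => v2r (f u) ord0 i) _ (cf (vcoord i))).
by move=> u; rewrite vcoordE.
Qed.

Lemma vcontmap_lin U W (f : 'Hom(U, W)) : vcontmap f.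
Proof.
move=> phi; apply: vcont_ext (vcont_lin ((phi \o f)%VF : dualv U)) => u.
by rewrite comp_lfunE.
Qed.

Lemma vclosed_preimage U W (f : U -> W) (D : set W) :
  vcontmap f -> vclosed D -> vclosed (f @^-1` D).
Proof.
move=> /vcontmap_continuous/continuous_closedP cf /cf; congr closed.
by apply/seteqP; split=> r /=; rewrite v2rK.
Qed.

Lemma vclosed_ge0 U (g : U -> R) : vcont g -> vclosed [set u | 0 <= g u].
Proof. by move=> /continuous_closedP /(_ _ (@closed_ge _ 0)). Qed.

Lemma vclosed_eq0 U (g : U -> R) : vcont g -> vclosed [set u | g u = 0].
Proof. by move=> /continuous_closedP /(_ _ (@closed_eq _ 0)). Qed.

Lemma vclosed_bigcap U (I : Type) (P : set I) (F : I -> set U) :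
  (forall i, P i -> vclosed (F i)) -> vclosed (\bigcap_(i in P) F i).
Proof. by move=> cF; apply: closed_bigI => i /cF. Qed.

Lemma vclosedI U (A B : set U) : vclosed A -> vclosed B -> vclosed (A `&` B).
Proof. exact: closedI. Qed.

Lemma vclosed_image U W p (K : set U) (f : U -> W) :
  vclosed K -> vcontmap f ->
  (forall (k : R) x, 0 <= k -> K x -> K (k *: x)) ->
  (forall (k : R) x, 0 <= k -> f (k *: x) = k ^+ p.+1 *: f x) ->
  (forall x, K x -> f x = 0 -> x = 0) -> vclosed (f @` K).
Proof.
move=> clK /vcontmap_continuous cf sK hf f0.
have : closed ((fun r => v2r (f (r2v r))) @` [set r | K (r2v r)]).
  apply: (@closed_image_homogeneous _ _ _ p) => //.
  - by move=> k x k0 /= Kx; rewrite linearZ; exact: sK.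
  - by move=> k x k0; rewrite linearZ hf // linearZ.
  move=> x Kx /= /eqP; rewrite -(inj_eq (can_inj r2vK)) v2rK linear0 => /eqP.
  by move=> /(f0 _ Kx) x0; rewrite -[x]r2vK x0 linear0.
congr closed; apply/seteqP; split=> r /=.
  by move=> [x Kx <-]; exists (r2v x) => //; rewrite v2rK.
by move=> [u Ku ur]; exists (v2r u); rewrite /= v2rK // ur r2vK.
Qed.

(** An auxiliary Euclidean structure, used for nearest points only. *)
Definition vdot V (u v : V) : R := \sum_i v2r u ord0 i * v2r v ord0 i.

Lemma vdotC V (u v : V) : vdot u v = vdot v u.
Proof. by apply: eq_bigr => i _; rewrite mulrC. Qed.

Lemma vdotDr V (u v w : V) : vdot u (v + w) = vdot u v + vdot u w.
Proof. by rewrite -big_split; apply: eq_bigr => i _; rewrite linearD mxE mulrDr. Qed.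

Lemma vdotZr V (k : R) (u v : V) : vdot u (k *: v) = k * vdot u v.
Proof. by rewrite mulr_sumr; apply: eq_bigr => i _; rewrite linearZ mxE mulrCA. Qed.

Lemma vdot_sqrD V (u v : V) (t : R) : vdot (u + t *: v) (u + t *: v) =
  vdot u u + 2 * t * vdot u v + t ^+ 2 * vdot v v.
Proof.
rewrite vdotDr vdotZr ![vdot (u + _) _]vdotC !vdotDr !vdotZr (vdotC v u).
by ring.
Qed.

Lemma vdot_gt0 V (u : V) : u != 0 -> 0 < vdot u u.
Proof.
move=> u0; rewrite lt_def sumr_ge0 ?andbT; last by move=> i _; exact: sqr_ge0.
apply: contra u0 => /eqP /psumr_eq0P uu; rewrite -(inj_eq (can_inj v2rK)) linear0.
apply/eqP/rowP => i; rewrite mxE; apply/eqP.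
by rewrite -sqrf_eq0 expr2 uu // => j _; exact: sqr_ge0.
Qed.

Definition vdotl V (u : V) : dualv V := linfun (fun v => vdot u v : R^o).

Lemma vdotlE V (u v : V) : vdotl u v = vdot u v.
Proof. by rewrite linfunE // => k x y; rewrite vdotDr vdotZr. Qed.

(** It suffices to minimise over the points of [K] that are at least as close
    to [x] as a given [c0]; these form a compact set. *)
Lemma nearest_point V (K : set V) (x : V) : K !=set0 -> vclosed K ->
  exists2 p, K p & forall c, K c -> vdot (p - x) (p - x) <= vdot (c - x) (c - x).
Proof.
move=> [c0 Kc0] clK; pose q c := vdot (c - x) (c - x).
have cq : vcont q.
  apply: vcont_sum => i.
  have ci : vcont (fun u : V => v2r (u - x) ord0 i).
    apply: vcont_ext (vcontD (vcont_lin (vcoord i)) (@vcont_cst V (vcoord i (- x)))).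
    by move=> u; rewrite !vcoordE linearD mxE.
  exact: vcontM.
pose b := q c0.
have b0 : 0 <= b by apply: sumr_ge0 => i _; exact: sqr_ge0.
pose Kb := [set r : 'rV[R]_(dim V) | K (r2v r) /\ q (r2v r) <= b].
have cKb : compact Kb.
  apply: bounded_closed_compact; last first.
    apply: closedI => //.
    by have /continuous_closedP /(_ [set r | r <= b]) := cq; apply; exact: closed_le.
  exists (`|v2r x| + (b + 1)); split; first exact: num_real.
  move=> M /ltW Mb r [_ qr]; apply: le_trans Mb.
  rewrite -[r](subrK (v2r x)) (le_trans (ler_normD _ _)) // addrC lerD2l.
  rewrite [leLHS]/Num.Def.normr /= mx_normrE; apply/bigmax_leP; split; first exact: addr_ge0.
  move=> [j i] _ /=; rewrite (ord1 j) leNgt; apply/negP => lt1.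
  have : (b + 1) ^+ 2 <= b.
    apply: le_trans qr; rewrite /q /vdot (bigD1 i) //= linearB /= -expr2 r2vK.
    rewrite -[leLHS]addr0; apply: lerD; last first.
      by apply: sumr_ge0 => k _; exact: sqr_ge0.
    rewrite -[leRHS]real_normK ?num_real // ler_sqr ?nnegrE ?addr_ge0 //; exact: ltW.
  by rewrite sqrrD1 => H; nra.
have Kb0 : Kb !=set0 by exists (v2r c0); rewrite /Kb /= v2rK; split=> //; exact: lexx.
have [p /set_mem [Kp qp] pmin] := EVT_min_rV Kb0 cKb (continuous_subspaceT cq).
exists (r2v p) => // c Kc; have [cb|bc] := leP (q c) b.
  have := pmin (v2r c); rewrite v2rK; apply; apply/mem_set.
  by rewrite /Kb /= v2rK.
exact: le_trans qp (ltW bc).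
Qed.

(** With [p] the point of [K] nearest to [x], the form [vdot (p - x)] separates:
    moving from [p] along a direction that stays in [K] cannot decrease the
    distance, and both [c] in [K] and [- p] are such directions. *)
Lemma cone_separation V (K : set V) (x : V) :
  closed_convex_cone K -> ~ K x -> exists2 phi, dual_cone K phi & (phi x : R) < 0.
Proof.
move=> [[K0 KD KZ] clK] nKx.
have [p Kp pmin] := nearest_point x (ex_intro _ 0 K0) clK.
pose u := p - x.
have u0 : u != 0.
  by apply/eqP => /eqP; rewrite subr_eq0 => /eqP px; apply: nKx; rewrite -px.
have var (v : V) : (forall t : R, 0 < t < 1 -> K (p + t *: v)) -> 0 <= vdot u v.
  move=> Kv; rewrite leNgt; apply/negP => uv.
  have vv : 0 <= vdot v v by apply: sumr_ge0 => i _; exact: sqr_ge0.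
  (* The quadratic function [t |-> |u + t v|^2] decreases near [0] because its
     derivative there is [- 2 a]; this [t] is small enough to witness it. *)
  pose a := - vdot u v; have a0 : 0 < a by rewrite /a oppr_gt0.
  pose t := a / (a + vdot v v + 1).
  have den : 0 < a + vdot v v + 1 by lra.
  have t01 : 0 < t < 1.
    by rewrite /t divr_gt0 //= ltr_pdivrMr // mul1r; lra.
  have := pmin _ (Kv t t01); rewrite addrAC -/u.
  rewrite vdot_sqrD.
  rewrite -(opprK (vdot u v)) -/a.
  have -> : a = t * (a + vdot v v + 1) by rewrite /t mulfVK // gt_eqF.
  by move: t01 => /andP[? ?]; nra.
exists (vdotl u).
  move=> c Kc; rewrite vdotlE; apply: var => t /andP[t0 _].
  by apply: KD => //; apply: KZ => //; exact: ltW.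
have up : 0 <= vdot u (- p).
  apply: var => t /andP[t0 t1]; rewrite scalerN -scaleNr -{1}[p]scale1r -scalerDl.
  by apply: KZ => //; lra.
have -> : x = p - u by rewrite /u opprB addrC subrK.
rewrite vdotlE vdotDr -[- u]scaleN1r vdotZr.
have := vdot_gt0 u0; move: up; rewrite -[- p]scaleN1r vdotZr; lra.
Qed.

Lemma dual_cone_closed V (K : set V) : closed_convex_cone (dual_cone K).
Proof.
split.
  split=> [x _|f g fK gK x Kx|k f k0 fK x Kx].
  - by rewrite lfunE.
  - by rewrite addvE addr_ge0 ?fK ?gK.
  - by rewrite scalevE mulr_ge0 ?fK.
have -> : dual_cone K = \bigcap_(x in K) [set phi | 0 <= (phi x : R)].
  by apply/seteqP; split.
apply: vclosed_bigcap => x _; apply: vclosed_ge0.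
by apply: vcont_ext (vcont_lin (lfun_ev x : dualv (dualv V))) => phi; rewrite lfun_evE.
Qed.

Lemma bipolar V (K : set V) (x : V) : closed_convex_cone K ->
  (forall phi, dual_cone K phi -> 0 <= (phi x : R)) -> K x.
Proof.
move=> cK h; apply: contrapT => /(cone_separation cK) [phi /h].
by rewrite leNgt => /negbTE ->.
Qed.

End VectorTopology.

Arguments vcont_lin {R U} phi.


(** * Generated cones and polyhedral cones *)

Section ConvexCones.
Variable R : realType.
Implicit Types V W : vectType R.

Lemma convex_cone_sum V (K : set V) (I : Type) (r : seq I) (P : pred I)
    (F : I -> V) :
  convex_cone K -> (forall i, P i -> K (F i)) -> K (\sum_(i <- r | P i) F i).
Proof. by move=> [K0 KD _] KF; elim/big_ind: _. Qed.

Lemma sub_cone_hull V (A : set V) : A `<=` cone_hull A.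
Proof. exact: sub_smallest. Qed.

Lemma cone_hull_convex V (A : set V) : convex_cone (cone_hull A).
Proof.
split=> [K [[]] //|x y Kx Ky K KA|k x k0 Kx K KA].
  by case: (KA) => [[_ KD _] _]; apply: KD; [exact: Kx | exact: Ky].
by case: (KA) => [[_ _ KZ] _]; apply: KZ => //; exact: Kx.
Qed.

Lemma cone_hull_min V (A K : set V) :
  convex_cone K -> A `<=` K -> cone_hull A `<=` K.
Proof. by move=> cK AK x; apply. Qed.

Lemma cone_hullZ V (A : set V) (k : R) x : 0 <= k -> A x -> cone_hull A (k *: x).
Proof. by move=> k0 /sub_cone_hull; have [_ _] := cone_hull_convex A; apply. Qed.

Lemma cone_hullS V (A B : set V) : A `<=` B -> cone_hull A `<=` cone_hull B.
Proof.
move=> AB; apply: cone_hull_min; first exact: cone_hull_convex.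
exact: subset_trans AB (@sub_cone_hull _ _).
Qed.

Lemma cone_hullE V (A : set V) (x : V) :
  A 0 -> (forall (k : R) a, 0 <= k -> A a -> A (k *: a)) ->
  cone_hull A x -> exists n (p : 'I_n -> V),
    (forall i, A (p i)) /\ x = \sum_i p i.
Proof.
move=> A0 AZ; move: x; apply: cone_hull_min; last first.
  by move=> x Ax; exists 1%N, (fun _ => x); split=> //; rewrite big_ord1.
split.
- by exists 0%N, (fun _ => 0); split=> [[]//|]; rewrite big_ord0.
- move=> x y [m [p [Ap ->]]] [n [q [Aq ->]]].
  exists (m + n)%N, (fun i => match split i with inl j => p j | inr j => q j end).
  split=> [i|]; first by case: split.
  rewrite big_split_ord /=; congr (_ + _); apply: eq_bigr => i _.
    by rewrite (unsplitK (inl i)).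
  by rewrite (unsplitK (inr i)).
move=> k x k0 [n [p [Ap ->]]]; exists n, (fun i => k *: p i).
by split=> [i|]; [exact: AZ | rewrite scaler_sumr].
Qed.

(** The number of summands is bounded independently of [x]: a linear relation
    between more than [\dim {:V}] summands can be used to rescale them so that
    one of them disappears. The padding by zero makes the number exact, which
    is what a parametrisation of the hull by one vector space needs. *)
Lemma caratheodory V (A : set V) (x : V) :
  A 0 -> (forall (k : R) a, 0 <= k -> A a -> A (k *: a)) ->
  cone_hull A x -> exists p : 'I_(\dim {:V}) -> V,
    (forall i, A (p i)) /\ x = \sum_i p i.
Proof.
move=> A0 AZ /(cone_hullE A0 AZ) [n]; set N := \dim _.
have pad m : (exists p : 'I_m -> V, (forall i, A (p i)) /\ x = \sum_i p i) ->
    exists p : 'I_m.+1 -> V, (forall i, A (p i)) /\ x = \sum_i p i.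
  move=> [p [Ap ->]].
  exists (fun i => if unlift ord0 i is Some j then p j else 0).
  split=> [i|]; first by case: unlift.
  rewrite big_ord_recl unlift_none add0r; apply: eq_bigr => i _.
  by rewrite liftK.
have cut m : (N <= m)%N ->
    (exists p : 'I_m.+1 -> V, (forall i, A (p i)) /\ x = \sum_i p i) ->
    exists p : 'I_m -> V, (forall i, A (p i)) /\ x = \sum_i p i.
  move=> Nm [p [Ap ->]].
  have [mu mup [i0 mui0]] : exists2 mu : 'I_m.+1 -> R,
      \sum_i mu i *: p i = 0 & exists i, 0 < mu i.
    pose X := [tuple p i | i < m.+1].
    have XE (i : 'I_m.+1) : X`_i = p i by rewrite -tnth_nth tnth_mktuple.
    have : ~~ free X.
      rewrite /free neq_ltn size_tuple ltnS (leq_trans _ Nm) //.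
      exact: dimvS (subvf _).
    move=> /freeP nX; have /existsNP [mu /not_implyP [mu0 /existsNP [i mui]]] := nX.
    have {}mu0 : \sum_i mu i *: p i = 0.
      by rewrite -[RHS]mu0; apply: eq_bigr => j _; rewrite XE.
    have [mui0|mui0|//] := ltrgtP (mu i) 0; last by exists mu => //; exists i.
    exists (fun j => - mu j); last by exists i; rewrite oppr_gt0.
    by under eq_bigr do rewrite scaleNr; rewrite sumrN mu0 oppr0.
  (* Subtracting [1 / mu k] times the relation keeps all coefficients
     nonnegative since [mu k] is maximal, and kills the [k]-th one. *)
  pose k := [arg max_(i > i0) mu i]%O.
  have kmax i : mu i <= mu k by rewrite /k; case: arg_maxP => // j _; apply.
  have k0 : 0 < mu k by exact: lt_le_trans (kmax i0).
  pose q i := (1 - mu i / mu k) *: p i.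
  have Aq i : A (q i).
    by apply: AZ => //; rewrite subr_ge0 ler_pdivrMr // mul1r.
  exists (fun i => q (lift k i)); split=> //.
  have -> : \sum_i p i = \sum_i q i.
    under [RHS]eq_bigr do rewrite /q scalerBl scale1r mulrC -scalerA.
    by rewrite sumrB -scaler_sumr mup scaler0 subr0.
  by rewrite (bigD1_ord k) //= {1}/q divff ?gt_eqF // subrr scale0r add0r.
have [nN|Nn] := leqP n N.
  rewrite -(subnK nN); elim: (N - n)%N => [//|d IH] /IH; rewrite addSn.
  exact: pad.
rewrite -(subnKC (ltnW Nn)); elim: (n - N)%N => [|d IH]; first by rewrite addn0.
by rewrite addnS => /cut; rewrite leq_addr => /(_ isT) /IH.
Qed.

Definition hcone V (s : seq (dualv V)) : set V :=
  [set x | forall phi, phi \in s -> 0 <= (phi x : R)].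

Lemma halfspaces_closed V (F : set (dualv V)) :
  closed_convex_cone [set x : V | forall phi, F phi -> 0 <= (phi x : R)].
Proof.
split.
  split=> [phi _|x y sx sy phi sphi|k x k0 sx phi sphi].
  - by rewrite linear0.
  - by rewrite linearD addr_ge0 ?sx ?sy.
  - by rewrite linearZ mulr_ge0 ?sx.
have -> : [set x : V | forall phi, F phi -> 0 <= (phi x : R)] =
    \bigcap_(phi in F) [set x | 0 <= (phi x : R)].
  by apply/seteqP; split.
by apply: vclosed_bigcap => phi _; apply: vclosed_ge0; exact: vcont_lin.
Qed.

Lemma hcone_closed V (s : seq (dualv V)) : closed_convex_cone (hcone s).
Proof. exact: halfspaces_closed [set` s]. Qed.

(** Eliminating [k] from the inequalities [0 <= phi x - k * phi v]: they bound
    [k] from below when [phi v < 0] and from above when [phi v > 0], and are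
    solvable by some [k >= 0] when each lower bound, [0] included, is at most
    each upper bound. The added form vanishes on [v] and expresses one such comparison. *)
Lemma fourier_motzkin V (s : seq (dualv V)) (v : V) :
  exists t, hcone t = [set x | exists2 k : R, 0 <= k & hcone s (x - k *: v)].
Proof.
pose s1 := [seq phi : dualv V <- s | 0 <= (phi v : R)].
pose s2 := [seq phi : dualv V <- s | (phi v : R) < 0].
exists (s1 ++ [seq (phi v : R) *: psi - (psi v : R) *: phi |
                 phi : dualv V <- s1, psi : dualv V <- s2]).
have phiE (phi : dualv V) x k : phi (x - k *: v) = phi x - k * phi v :> R.
  by rewrite linearB linearZ.
apply/seteqP; split=> x /=.
  (* The least admissible value, the largest of all lower bounds. *)
  move=> tx; pose k := \big[Num.max/0]_(psi <- s2) ((psi x : R) / psi v).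
  exists k; first exact: bigmax_ge_id.
  move=> phi sphi; rewrite phiE subr_ge0.
  have [phi0|phi0] := leP 0 (phi v : R); last first.
    rewrite -ler_ndivrMr //; apply: (@bigmax_sup_seq _ _ _ _ _ phi) => //.
    by rewrite mem_filter phi0.
  have phi1 : phi \in s1 by rewrite mem_filter phi0.
  have phix : 0 <= (phi x : R) by apply: tx; rewrite mem_cat phi1.
  have [v0|v0] := eqVneq (phi v : R) 0; first by rewrite v0 mulr0.
  have {v0}phi0 : 0 < (phi v : R) by rewrite lt_def v0.
  rewrite -ler_pdivlMr //; rewrite /k big_seq.
  apply: bigmax_le; first by rewrite divr_ge0 // ltW.
  move=> psi psi2; have psi0 : (psi v : R) < 0.
    by move: psi2; rewrite mem_filter => /andP[].
  have : 0 <= (((phi v : R) *: psi - (psi v : R) *: phi : dualv V) x : R).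
    by apply: tx; rewrite mem_cat; apply/orP; right; apply: allpairs_f.
  rewrite addvE opp_lfunE !scalevE ler_ndivrMr // mulrAC ler_pdivrMr //.
  rewrite /GRing.scale /=; nra.
move=> [k k0 sx] phi; rewrite mem_cat => /orP[|/allpairsP [[f g] /= [f1 g2 ->]]].
  rewrite mem_filter => /andP[phi0 /sx]; rewrite phiE; nra.
move: f1 g2; rewrite !mem_filter => /andP[f0 /sx fx] /andP[g0 /sx gx].
move: fx gx; rewrite !phiE addvE opp_lfunE !scalevE /GRing.scale /=.
have lem (a b c d : R) : 0 <= a -> b < 0 -> 0 <= c - k * a -> 0 <= d - k * b ->
  0 <= a * d - b * c by nra.
exact: lem.
Qed.

(** The easy half of the Minkowski-Weyl theorem, adding the generators one at a
    time; in particular finitely generated cones are closed. *)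
Lemma finite_cone_hcone V (s : seq V) : exists t, cone_hull [set` s] = hcone t.
Proof.
elim: s => [|v s [t IH]].
  exists (flatten [seq [:: cobasisv i; - cobasisv i] | i <- enum 'I_(\dim {:V})]).
  apply/seteqP; split=> x.
    apply: cone_hull_min; first by have [] := hcone_closed (flatten
      [seq [:: cobasisv i; - cobasisv i] | i <- enum 'I_(\dim {:V})]).
    by move=> y.
  move=> tx; suff -> : x = 0 by have [] := cone_hull_convex [set` [::] : seq V].
  rewrite (basisv_sum x); apply: big1 => i _.
  suff -> : (cobasisv i x : R) = 0 by rewrite scale0r.
  apply/eqP; rewrite eq_le; apply/andP; split.
    rewrite -oppr_ge0 -(opp_lfunE (cobasisv i) x); apply: tx.
    by apply/flatten_mapP; exists i; rewrite ?mem_enum // !inE eqxx orbT.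
  by apply: tx; apply/flatten_mapP; exists i; rewrite ?mem_enum // !inE eqxx.
have [u uE] := fourier_motzkin t v; exists u; rewrite uE -IH.
have [H0 HD HZ] := cone_hull_convex [set` s].
have [G0 GD GZ] := cone_hull_convex [set` v :: s].
apply/seteqP; split.
  apply: cone_hull_min.
    split.
    - by exists 0 => //; rewrite scale0r subr0.
    - move=> x y [k k0 Hx] [l l0 Hy]; exists (k + l); first exact: addr_ge0.
      by rewrite scalerDl opprD addrACA; exact: HD.
    - move=> k x k0 [l l0 Hx]; exists (k * l); first exact: mulr_ge0.
      by rewrite -scalerA -scalerBr; exact: HZ.
  move=> x; rewrite /= inE => /orP[/eqP->|sx].
    by exists 1 => //; rewrite scale1r subrr.
  by exists 0 => //; rewrite scale0r subr0; exact: sub_cone_hull.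
move=> x [k k0 Hx]; rewrite -(subrK (k *: v) x); apply: GD.
  apply: cone_hullS Hx => y /=; rewrite inE => ->; exact: orbT.
by apply: cone_hullZ => //=; rewrite inE eqxx.
Qed.

Lemma finite_cone_closed V (s : seq V) : closed_convex_cone (cone_hull [set` s]).
Proof. by have [t ->] := finite_cone_hcone s; exact: hcone_closed. Qed.

(** Farkas' lemma: the cone on the right is closed, so it can be recovered from
    its dual, which is [hcone s] up to the identification of [V] with its
    bidual. *)
Lemma dual_hcone V (s : seq (dualv V)) :
  dual_cone (hcone s) = cone_hull [set` s].
Proof.
apply/seteqP; split=> [phi sphi|]; last first.
  apply: cone_hull_min; first by have [] := dual_cone_closed (hcone s).
  by move=> phi sphi x; apply.
apply: bipolar; first exact: finite_cone_closed.
move=> x sx; rewrite -lfun_unev_dual; apply: sphi => psi spsi.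
by rewrite lfun_unev_dual; apply: sx; exact: sub_cone_hull.
Qed.

(** For the converse half, the dual of [hcone s] is generated by [s], hence cut
    out by finitely many inequalities; these are evaluations at points of [V],
    and the points generate [hcone s] by the bipolar theorem. *)
Lemma polyhedral_hcone V (D : set V) : polyhedral D <-> exists s, D = hcone s.
Proof.
split=> [[A /finite_seqP [s ->] ->]|[s ->]]; first exact: finite_cone_hcone.
have [t tE] := finite_cone_hcone s.
exists [set` map (@lfun_unev R V) t]; first by apply/finite_seqP; eexists.
apply/seteqP; split=> x; last first.
  apply: cone_hull_min; first by have [] := hcone_closed s.
  move=> _ /= /mapP [y ty ->] phi sphi; rewrite lfun_unev_dual.
  have : hcone t phi by rewrite -tE; exact: sub_cone_hull.
  exact.
move=> sx; apply: bipolar; first exact: finite_cone_closed.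
move=> phi tphi; have : dual_cone (hcone s) phi; last by apply.
rewrite dual_hcone tE => y ty; rewrite -lfun_unev_dual; apply: tphi.
by apply: sub_cone_hull; exact: map_f.
Qed.

Lemma spanning_seq V (A : set V) : exists s : seq V,
  (forall x, x \in s -> A x) /\ (forall x, A x -> x \in <<s>>%VS).
Proof.
pose P n := `[< exists2 s : seq V, (forall x, x \in s -> A x) & \dim <<s>> = n >].
have P0 : exists n, P n by exists (\dim <<[::] : seq V>>); apply/asboolP; exists [::].
have Pb n : P n -> (n <= \dim {:V})%N.
  by move=> /asboolP [s _ <-]; exact: dimvS (subvf _).
have [n /asboolP [s As sn] nmax] := ex_maxnP P0 Pb; exists s; split=> // x Ax.
have : (\dim <<x :: s>> <= n)%N.
  apply: nmax; apply/asboolP; exists (x :: s) => // y.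
  by rewrite inE => /orP[/eqP->//|/As].
rewrite -sn span_cons => h; have /eqP E : (<<s>> == <[x]> + <<s>>)%VS.
  by rewrite eqEdim addvSr.
by rewrite E; apply: subvP (addvSl _ _) _ (memv_line x).
Qed.

End ConvexCones.

(** * Closedness of the minimal tensor product *)

Section TensorCones.
Variable R : realType.
Implicit Types U V W : vectType R.

(** A point in the relative interior of the dual cone: the sum of elements of the
    dual cone that span it vanishes at [c] in [C] only if the whole dual cone
    does, which by the bipolar theorem puts [- c] in [C]. *)
Lemma strict_dual V (C : set V) : closed_convex_cone C ->
  exists2 phi, dual_cone C phi & forall c, C c -> (phi c : R) = 0 -> C (- c).
Proof.
move=> cC; have [s [sC Cs]] := spanning_seq (dual_cone C).
exists (\sum_(f <- s) f).
  rewrite big_seq; apply: convex_cone_sum => [|f /sC //].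
  by have [] := dual_cone_closed C.
move=> c Cc; rewrite sum_lfunE big_seq => /eqP.
rewrite psumr_eq0 => [/allP s0|f /sC]; last exact.
apply: (bipolar cC) => f /Cs fs; rewrite linearN oppr_ge0 le_eqVlt; apply/orP; left.
have : (<<s>> <= lker (lfun_ev c : 'Hom(dualv V, R^o)))%VS.
  apply/span_subvP => g gs; rewrite memv_ker lfun_evE.
  by have := s0 g gs; rewrite gs.
by move=> /subvP /(_ f fs); rewrite memv_ker lfun_evE.
Qed.

Lemma pureDl V W (v v' : V) (w : W) : pure (v + v') w = pure v w + pure v' w.
Proof. exact: Defs.linearD (pure_linl w) v v'. Qed.

Lemma pureDr V W (v : V) (w w' : W) : pure v (w + w') = pure v w + pure v w'.
Proof. exact: Defs.linearD (pure_linr v) w w'. Qed.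

Lemma pureZl V W (k : R) (v : V) (w : W) : pure (k *: v) w = k *: pure v w.
Proof. exact: linear_Z (pure_linl w) k v. Qed.

Lemma pureZr V W (k : R) (v : V) (w : W) : pure v (k *: w) = k *: pure v w.
Proof. exact: linear_Z (pure_linr v) k w. Qed.

Lemma pureBl V W (v v' : V) (w : W) : pure (v - v') w = pure v w - pure v' w.
Proof. by rewrite pureDl -scaleN1r pureZl scaleN1r. Qed.

Lemma pureBr V W (v : V) (w w' : W) : pure v (w - w') = pure v w - pure v w'.
Proof. by rewrite pureDr -scaleN1r pureZr scaleN1r. Qed.

Lemma pure0l V W (w : W) : pure (0 : V) w = 0.
Proof. exact: linear_0 (pure_linl w). Qed.

Lemma pure0r V W (v : V) : pure v (0 : W) = 0.
Proof. exact: linear_0 (pure_linr v). Qed.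

Lemma min_tensE V W (C : set V) (D : set W) :
  convex_cone C ->
  min_tens C D = cone_hull [set t | exists c d, [/\ C c, D d & t = pure c d]].
Proof.
move=> [C0 CD CZ]; apply/seteqP; split=> t.
  move=> [n [c [d [Cc Dd ->]]]].
  apply: convex_cone_sum => [|i _]; first exact: cone_hull_convex.
  by apply: sub_cone_hull; exists (c i), (d i).
apply: cone_hull_min; last first.
  move=> _ [c [d [Cc Dd ->]]].
  by exists 1%N, (fun=> c), (fun=> d); rewrite big_ord1.
split.
- by exists 0%N, (fun=> 0), (fun=> 0); rewrite big_ord0; split=> // -[].
- move=> _ _ [m [a [b [Ca Db ->]]]] [n [c [d [Cc Dd ->]]]].
  exists (m + n)%N, (fun i => match split i with inl j => a j | inr j => c j end),
    (fun i => match split i with inl j => b j | inr j => d j end).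
  split=> [i|i|]; try by case: split.
  rewrite big_split_ord /=; congr (_ + _); apply: eq_bigr => i _.
    by rewrite (unsplitK (inl i)).
  by rewrite (unsplitK (inr i)).
move=> k _ k0 [n [c [d [Cc Dd ->]]]]; exists n, (fun i => k *: c i), d.
split=> // [i|]; first exact: CZ.
by rewrite scaler_sumr; apply: eq_bigr => i _; rewrite pureZl.
Qed.

Lemma min_tens_convex V W (C : set V) (D : set W) :
  convex_cone C -> convex_cone (min_tens C D).
Proof. by move=> /min_tensE ->; exact: cone_hull_convex. Qed.

Lemma min_tens_pure V W (C : set V) (D : set W) c d :
  C c -> D d -> min_tens C D (pure c d).
Proof. by move=> Cc Dd; exists 1%N, (fun=> c), (fun=> d); rewrite big_ord1. Qed.

Lemma vcont_linear U (h : U -> R^o) : linear h -> vcont (h : U -> R).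
Proof.
by move=> lh; apply: vcont_ext (vcont_lin (linfun h : dualv U)) => u; rewrite linfunE.
Qed.

Lemma vcontmap_pure U V W (f : 'Hom(U, V)) (g : 'Hom(U, W)) :
  vcontmap (fun u => pure (f u) (g u)).
Proof.
move=> theta.
apply: (@vcont_ext _ _ (fun u => \sum_i
    (dualfun f (cobasisv i) u * theta (pure (basisv i) (g u)) : R))) => [u|].
  rewrite (basisv_sum (f u)) (linear_sumE (pure_linl _)) linear_sum.
  by apply: eq_bigr => i _; rewrite pureZl linearZ dualfunE.
apply: vcont_sum => i.
apply: vcontM; first exact: vcont_lin.
apply: (@vcont_linear _ (fun u => theta (pure (basisv i) (g u)))).
exact: (linear_comp (lfun_linear theta)
  (linear_comp (pure_linr (basisv i)) (lfun_linear g))).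
Qed.

Lemma vclosed_ker U V (f : 'Hom(U, V)) : vclosed [set u | f u = 0].
Proof.
have -> : [set u | f u = 0] =
    \bigcap_(phi in [set: dualv V]) [set u | (phi (f u) : R) = 0].
  apply/seteqP; split=> u /= fu => [phi _ /=|]; first by rewrite fu linear0.
  by apply: dualv_sep => phi; rewrite fu // linear0.
apply: vclosed_bigcap => phi _; apply: vclosed_eq0; exact: vcontmap_lin.
Qed.

(** [P] is a projection along the largest linear subspace of [Q]. *)
Lemma lineality_projection V (Q : set V) : convex_cone Q ->
  exists P : 'End(V), (forall x, P x = 0 <-> Q x /\ Q (- x)) /\
    (forall x, Q (x - P x) /\ Q (P x - x)).
Proof.
move=> [Q0 QD QZ]; pose L := [set x | Q x /\ Q (- x)].
have [s [sL Ls]] := spanning_seq L.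
have LE x : x \in <<s>>%VS -> L x.
  move=> xs; rewrite (coord_span (X := in_tuple s) xs); elim/big_ind: _.
  - by split; rewrite ?oppr0.
  - by move=> y z [Qy Qy'] [Qz Qz']; split; rewrite ?opprD; exact: QD.
  move=> i _; have [Qi Qi'] : L s`_i by apply: sL; exact: mem_nth.
  set k := coord _ _ _; split.
    have [k0|/ltW k0] := leP 0 k; first exact: QZ.
    by rewrite -[k]opprK scaleNr -scalerN; apply: QZ => //; rewrite oppr_ge0.
  have [k0|/ltW k0] := leP 0 k; first by rewrite -scalerN; exact: QZ.
  by rewrite -scaleNr; apply: QZ => //; rewrite oppr_ge0.
exists (\1%VF - projv <<s>>%VS)%VF.
have PE x : (\1%VF - projv <<s>>%VS)%VF x = x - projv <<s>>%VS x.
  by rewrite addvE opp_lfunE id_lfunE.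
split=> x; rewrite PE.
  split=> [/eqP|/Ls xs]; last by rewrite projv_id ?subrr.
  rewrite subr_eq0 => /eqP ->; apply: LE; exact: memv_proj.
by rewrite opprB addrCA subrr addr0 addrAC subrr add0r; apply: LE; exact: memv_proj.
Qed.

(** A closed cone [C] is the sum of a linear subspace, the kernel of [P], and of
    the salient cone formed by its elements fixed by [P], on which [phi] is
    strictly positive away from the origin. *)
Lemma salient_part V (C : set V) : closed_convex_cone C ->
  exists (P : 'End(V)) (phi : dualv V), [/\ dual_cone C phi,
    forall x, C (x - P x) /\ C (P x - x),
    forall c, C c -> C (P c) /\ P (P c) = P c &
    forall c, C c -> P c = c -> (phi c : R) = 0 -> c = 0].
Proof.
move=> cC; have [_ CD _] := cC.1; have [phi Cphi phi0] := strict_dual cC.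
have [P [P0 PC]] := lineality_projection cC.1; exists P, phi; split=> //.
  move=> c Cc; split.
    by rewrite -(subrK c (P c)); apply: CD => //; have [] := PC c.
  apply/eqP; rewrite -subr_eq0 -linearB; apply/eqP/P0; rewrite opprB.
  by have [] := PC c.
by move=> c Cc Pc c0; rewrite -Pc; apply/P0; split=> //; exact: phi0.
Qed.

Lemma pure_balance V W (phi : dualv V) (psi : dualv W) v w :
  0 < (phi v : R) -> 0 < (psi w : R) ->
  exists2 k : R, 0 < k & (phi (k *: v) : R) = psi (k^-1 *: w).
Proof.
move=> v0 w0; exists (Num.sqrt ((psi w : R) / phi v)).
  by rewrite sqrtr_gt0 divr_gt0.
set k := Num.sqrt _; have k0 : 0 < k by rewrite sqrtr_gt0 divr_gt0.
have kk : k ^+ 2 = (psi w : R) / phi v by rewrite sqr_sqrtr // divr_ge0 // ltW.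
rewrite !linearZ /=; have -> : (psi w : R) = k ^+ 2 * phi v.
  by rewrite kk mulfVK // gt_eqF.
by rewrite expr2 -mulrA [RHS]mulKf // gt_eqF.
Qed.

(** Let [P] project along the largest linear subspace of [min_tens C D]. It is
    enough that the image under [P] is closed. In this image, [C] and [D] may be
    replaced by their salient parts, because tensors with a factor in the
    linear part of [C] or [D] are killed. By Caratheodory's theorem, a fixed
    number of pure tensors suffices, and their factors can be normalised by
    [phi c = psi d]. So the image is parametrised by a closed cone [K] through a
    map that is homogeneous of degree two, and this map has no nontrivial zeros
    on [K] because [phi] and [psi] are strictly positive. *)
Lemma min_tens_closed V W (C : set V) (D : set W) :
  closed_convex_cone C -> closed_convex_cone D ->
  closed_convex_cone (min_tens C D).
Proof.
move=> cC cD; have [[C0 CD CZ] clC] := cC; have [[D0 DD DZ] clD] := cD.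
have cQ := min_tens_convex D cC.1; split=> //.
set Q := min_tens C D in cQ *; have [Q0 QD QZ] := cQ.
have [PC [phi [Cphi PCC CPC phi_gt0]]] := salient_part cC.
have [PD [psi [Dpsi PDD DPD psi_gt0]]] := salient_part cD.
have [P [P0 _]] := lineality_projection cQ.
pose C' := [set c | C c /\ PC c = c]; pose D' := [set d | D d /\ PD d = d].
pose N := \dim {:tensv V W}.
pose U : vectType R := {ffun 'I_N -> V * W}.
have lin1 j : linear (fun u : U => (u j).1) by move=> k x y; rewrite !ffunE.
have lin2 j : linear (fun u : U => (u j).2) by move=> k x y; rewrite !ffunE.
pose p1 j : 'Hom(U, V) := linfun (fun u : U => (u j).1).
pose p2 j : 'Hom(U, W) := linfun (fun u : U => (u j).2).
have p1E j u : p1 j u = (u j).1 by rewrite linfunE.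
have p2E j u : p2 j u = (u j).2 by rewrite linfunE.
pose K := [set u : U | forall j, [/\ C' (p1 j u), D' (p2 j u) &
  (phi (p1 j u) : R) = psi (p2 j u)]].
pose f (u : U) := P (\sum_j pure (p1 j u) (p2 j u)).
have clK : vclosed K.
  have -> : K = \bigcap_(j in [set: 'I_N])
      (((p1 j @^-1` C) `&` [set u | (PC \o p1 j - p1 j)%VF u = 0]) `&`
       ((p2 j @^-1` D) `&` [set u | (PD \o p2 j - p2 j)%VF u = 0]) `&`
       [set u | (dualfun (p1 j) phi - dualfun (p2 j) psi)%VF u = 0]).
    have subE (Z : vectType R) (g h : 'Hom(U, Z)) u : ((g - h)%VF u = 0) <-> (g u = h u).
      by rewrite addvE opp_lfunE; split=> [/eqP|->]; rewrite ?subrr // subr_eq0 => /eqP.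
    apply/seteqP; split=> u Ku j => [_|]; have := Ku j.
      move=> [[? e1] [? e2] e3]; split; [split; split=> //=|].
      - by apply/subE; rewrite comp_lfunE.
      - by apply/subE; rewrite comp_lfunE.
      - by apply/subE; rewrite !dualfunE.
    move=> /(_ Logic.I) [[[? /subE +] [? /subE +]] /subE].
    by rewrite !comp_lfunE !dualfunE.
  apply: vclosed_bigcap => j _; apply: vclosedI; last exact: vclosed_ker.
  by apply: vclosedI; apply: vclosedI; (try exact: vclosed_ker);
    apply: vclosed_preimage => //; exact: vcontmap_lin.
have cf : vcontmap f.
  move=> theta; apply: (@vcont_ext _ _
    (fun u => \sum_j ((theta \o P)%VF (pure (p1 j u) (p2 j u)) : R))).
    by move=> u; rewrite /f !linear_sum; apply: eq_bigr => j _; rewrite comp_lfunE.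
  by apply: vcont_sum => j; exact: vcontmap_pure.
(* [phi] and [psi] induce a form on the tensor product, nonnegative on [Q]. *)
have Qdual t : Q t -> 0 <= (psi (t phi) : R).
  move=> [n [c [d [Cc Dd ->]]]]; rewrite sum_lfunE linear_sum.
  apply: sumr_ge0 => i _; rewrite pureE linearZ.
  by apply: mulr_ge0; [exact: Cphi | exact: Dpsi].
have clPQ : vclosed (f @` K).
  apply: (@vclosed_image _ _ _ 1) => //.
  - move=> k x k0 Kx j; have [[Cx Px] [Dx Px'] e] := Kx j.
    rewrite !linearZ; split; first by split; [exact: CZ | rewrite linearZ /= Px].
      by split; [exact: DZ | rewrite linearZ /= Px'].
    by congr (_ * _).
  - move=> k x k0; rewrite /f -linearZ scaler_sumr; congr (P _).
    by apply: eq_bigr => j _; rewrite !linearZ pureZl pureZr scalerA expr2.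
  move=> u Ku /P0 [_ Qu].
  have u0 : \sum_j (phi (p1 j u) * psi (p2 j u) : R) = 0.
    apply/eqP; rewrite eq_le; apply/andP; split.
      have : 0 <= (psi ((- \sum_j pure (p1 j u) (p2 j u)) phi) : R).
        exact: Qdual.
      rewrite opp_lfunE linearN oppr_ge0 sum_lfunE linear_sum.
      by under eq_bigr do rewrite pureE linearZ.
    apply: sumr_ge0 => j _; have [[Cj _] [Dj _] _] := Ku j.
    by apply: mulr_ge0; [exact: Cphi | exact: Dpsi].
  apply/ffunP => j; rewrite !ffunE.
  have [Cj Dj e] := Ku j.
  have phij : (phi (p1 j u) : R) = 0.
    move/eqP: u0; rewrite psumr_eq0 => [/allP /(_ j)|i _]; last first.
      have [[Ci _] [Di _] _] := Ku i.
      by apply: mulr_ge0; [exact: Cphi | exact: Dpsi].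
    by rewrite mem_index_enum -e -expr2 sqrf_eq0 => /(_ isT) /eqP.
  rewrite [u j]surjective_pairing -p1E -p2E (phi_gt0 _ Cj.1 Cj.2 phij).
  by rewrite (psi_gt0 _ Dj.1 Dj.2) // -e.
(* [K] contains a representative of each element of [Q] modulo the kernel of
   [P]. *)
have PQK : f @` K = P @` Q.
  apply/seteqP; split=> [_ [u Ku <-]|_ [t [n [c [d [Cc Dd ->]]]] <-]].
    exists (\sum_j pure (p1 j u) (p2 j u)) => //.
    apply: convex_cone_sum => // j _; have [[Cj _] [Dj _] _] := Ku j.
    exact: min_tens_pure.
  pose A := [set t | exists c d, [/\ C' c, D' d & t = pure c d]].
  have C'Z (k : R) a : 0 <= k -> C' a -> C' (k *: a).
    by move=> k0 [Ca Pa]; split; [exact: CZ | rewrite linearZ /= Pa].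
  have D'Z (k : R) a : 0 <= k -> D' a -> D' (k *: a).
    by move=> k0 [Da Pa]; split; [exact: DZ | rewrite linearZ /= Pa].
  have C'0 : C' 0 by split; rewrite ?linear0.
  have D'0 : D' 0 by split; rewrite ?linear0.
  have A0 : A 0 by exists 0, 0; rewrite pure0l.
  have AZ (k : R) a : 0 <= k -> A a -> A (k *: a).
    move=> k0 [x [y [Cx Dy ->]]]; exists (k *: x), y.
    by rewrite pureZl; split=> //; exact: C'Z.
  have At : cone_hull A (\sum_i pure (PC (c i)) (PD (d i))).
    apply: convex_cone_sum => [|i _]; first exact: cone_hull_convex.
    apply: sub_cone_hull; exists (PC (c i)), (PD (d i)); split=> //.
      exact: CPC.
    exact: DPD.
  have Pc x y : C x -> D y -> P (pure (PC x) (PD y)) = P (pure x y).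
    move=> Cx Dy; have [Cx1 Cx2] := PCC x; have [Dy1 Dy2] := PDD y.
    apply/eqP; rewrite -subr_eq0 -linearB; apply/eqP/P0.
    rewrite opprB; split.
      have -> : pure (PC x) (PD y) - pure x y =
          pure (PC x - x) (PD y) + pure x (PD y - y).
        by rewrite pureBl pureBr addrA subrK.
      by apply: QD; apply: min_tens_pure => //; have [] := DPD _ Dy.
    have -> : pure x y - pure (PC x) (PD y) =
        pure (x - PC x) (PD y) + pure x (y - PD y).
      by rewrite pureBl pureBr [RHS]addrC addrA subrK.
    by apply: QD; apply: min_tens_pure => //; have [] := DPD _ Dy.
  have [q [Aq tq]] := caratheodory A0 AZ At.
  have bal j : exists xy : V * W, [/\ C' xy.1, D' xy.2,
      (phi xy.1 : R) = psi xy.2 & q j = pure xy.1 xy.2].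
    have [c' [d' [Cc' Dd' ->]]] := Aq j.
    have [c0|c0] := eqVneq (phi c' : R) 0.
      exists (0, 0) => /=; rewrite (phi_gt0 _ Cc'.1 Cc'.2 c0) !pure0l !linear0.
      by split.
    have [d0|d0] := eqVneq (psi d' : R) 0.
      exists (0, 0) => /=; rewrite (psi_gt0 _ Dd'.1 Dd'.2 d0) !pure0r !linear0.
      by split.
    have {}c0 : 0 < (phi c' : R) by rewrite lt_def c0; exact: Cphi Cc'.1.
    have {}d0 : 0 < (psi d' : R) by rewrite lt_def d0; exact: Dpsi Dd'.1.
    have [k k0 kE] := pure_balance c0 d0.
    exists (k *: c', k^-1 *: d') => /=; split=> //.
    - by apply: C'Z => //; exact: ltW.
    - by apply: D'Z => //; rewrite invr_ge0 ltW.
    by rewrite pureZl pureZr scalerA divff ?scale1r // gt_eqF.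
  have {bal} [u uP] := choice bal.
  exists [ffun j => u j].
    by move=> j; rewrite p1E p2E ffunE; have [] := uP j.
  transitivity (P (\sum_i pure (PC (c i)) (PD (d i)))).
    rewrite /f tq; congr (P _); apply: eq_bigr => j _.
    by rewrite p1E p2E ffunE; have [] := uP j.
  by rewrite !linear_sum; apply: eq_bigr => i _; exact: Pc.
have -> : Q = P @^-1` (P @` Q).
  apply/seteqP; split=> [t Qt|t [q Qq]] /=; first by exists t.
  move=> /eqP; rewrite eq_sym -subr_eq0 -linearB => /eqP /P0 [Qtq _].
  by rewrite -(subrK q t); exact: QD.
by rewrite -PQK; apply: vclosed_preimage => //; exact: vcontmap_lin.
Qed.

(** * Closed conic hulls *)

Lemma vclosure_closed V (K : set V) : vclosed (vclosure K).
Proof.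
rewrite /vclosed; set F := [set r | _].
have -> : F = closure [set r : 'rV[R]_(dim V) | K (r2v r)].
  by apply/seteqP; split=> r; rewrite /F /vclosure /= r2vK.
exact: closed_closure.
Qed.

Lemma sub_vclosure V (K : set V) : K `<=` vclosure K.
Proof. by move=> v Kv; apply: subset_closure; rewrite /= v2rK. Qed.

Lemma vclosure_min V (K F : set V) : vclosed F -> K `<=` F -> vclosure K `<=` F.
Proof.
move=> clF KF v; rewrite /vclosure /= closureE => /(_ [set r | F (r2v r)]) /=.
by rewrite v2rK; apply; split=> // r; exact: KF.
Qed.

Lemma vclosed_shift V (K : set V) (y : V) :
  vclosed K -> vclosed [set x | K (x + y)].
Proof.
apply: vclosed_preimage => phi.
apply: (@vcont_ext _ _ (fun x => (phi x : R) + phi y)) => [x|].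
  by rewrite linearD.
by apply: vcontD; [exact: vcont_lin | exact: vcont_cst].
Qed.

Lemma vclosed_scale V (K : set V) (k : R) :
  vclosed K -> vclosed [set x | K (k *: x)].
Proof.
apply: vclosed_preimage => phi.
apply: (@vcont_ext _ _ (fun x => k * (phi x : R))) => [x|].
  by rewrite linearZ.
by apply: vcontM; [exact: vcont_cst | exact: vcont_lin].
Qed.

(** Closedness under addition is checked one summand at a time, so that
    minimality of the closure applies to a translate of it. *)
Lemma vclosure_convex V (K : set V) : convex_cone K -> convex_cone (vclosure K).
Proof.
move=> [K0 KD KZ]; have clK := @vclosure_closed _ K; split.
- exact: sub_vclosure.
- move=> x y Kx Ky; rewrite addrC.
  have sub : vclosure K `<=` [set z | vclosure K (z + x)]; last exact: sub Ky.
  apply: vclosure_min; first exact: vclosed_shift.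
  move=> z Kz /=; rewrite addrC.
  have sub : vclosure K `<=` [set w | vclosure K (w + z)]; last exact: sub Kx.
  apply: vclosure_min; first exact: vclosed_shift.
  by move=> w Kw /=; apply: sub_vclosure; exact: KD.
move=> k x k0 Kx.
have sub : vclosure K `<=` [set z | vclosure K (k *: z)]; last exact: sub Kx.
apply: vclosure_min; first exact: vclosed_scale.
by move=> z Kz; apply: sub_vclosure; exact: KZ.
Qed.

Lemma closed_cone_hull_closed V (A : set V) :
  closed_convex_cone (closed_cone_hull A).
Proof.
split; last exact: vclosure_closed.
by apply: vclosure_convex; exact: cone_hull_convex.
Qed.

Lemma sub_closed_cone_hull V (A : set V) : A `<=` closed_cone_hull A.
Proof. exact: subset_trans (@sub_cone_hull _ _ _) (@sub_vclosure _ _). Qed.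

Lemma closed_cone_hull_min V (A K : set V) :
  closed_convex_cone K -> A `<=` K -> closed_cone_hull A `<=` K.
Proof. by move=> [cK clK] AK; apply: vclosure_min => //; exact: cone_hull_min. Qed.

Lemma preimage_closed_cone V W (f : 'Hom(V, W)) (K : set W) :
  closed_convex_cone K -> closed_convex_cone (f @^-1` K).
Proof.
move=> [[K0 KD KZ] clK]; split; last first.
  by apply: vclosed_preimage => //; exact: vcontmap_lin.
split=> [|x y Kx Ky|k x k0 Kx] /=; rewrite ?linear0 ?linearD ?linearZ //.
  exact: KD.
exact: KZ.
Qed.

(** * Duality between the minimal and maximal tensor products *)

Lemma tens_canonE V W (t : tensv V W) (phi : dualv V) (psi : dualv W) :
  tens_canon V W t (pure phi psi) = psi (t phi).
Proof.
rewrite [t]tens_sum !linear_sum !sum_lfunE linear_sum /=.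
apply: eq_bigr => i _; rewrite tens_canon_pure pureE linearZ //.
Qed.

Lemma max_tensP V W (C : set V) (D : set W) (t : tensv V W) :
  max_tens C D t <-> forall phi psi, dual_cone C phi -> dual_cone D psi ->
    0 <= (psi (t phi) : R).
Proof.
split=> [Ct phi psi Cphi Dpsi|h _ [n [phi [psi [Cphi Dpsi ->]]]]].
  by rewrite -tens_canonE; apply: Ct; exact: min_tens_pure.
rewrite (linear_sumE (lfun_linear _)); apply: sumr_ge0 => i _.
rewrite tens_canonE; exact: h.
Qed.

Lemma tens_canon_surj V W (theta : dualv (tensv (dualv V) (dualv W))) :
  exists t, tens_canon V W t = theta.
Proof.
exists (\sum_i \sum_j (theta (pure (cobasisv i) (cobasisv j)) : R) *:
  pure (basisv i) (basisv j)).
apply: tens_ext => phi psi.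
rewrite (linear_sumE (lfun_linear (tens_canon V W))) sum_lfunE.
rewrite [in RHS](dual_sum phi) (linear_sumE (pure_linl _)).
rewrite (linear_sumE (lfun_linear theta)).
apply: eq_bigr => i _; rewrite (linear_sumE (lfun_linear (tens_canon V W))) sum_lfunE.
rewrite pureZl (linear_Z (lfun_linear theta)) [in RHS](dual_sum psi).
rewrite (linear_sumE (pure_linr _)) (linear_sumE (lfun_linear theta)) scaler_sumr.
apply: eq_bigr => j _.
rewrite (linear_Z (lfun_linear _)) scalevE tens_canon_pure pureZr.
rewrite (linear_Z (lfun_linear theta)) /GRing.scale /=.
by rewrite [LHS]mulrC -[LHS]mulrA.
Qed.

Lemma tens_canon_functional V W (F : dualv (tensv V W)) :
  exists q, forall t, F t = tens_canon V W t q.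
Proof.
exists (\sum_i pure (cobasisv i) (linfun (fun w => F (pure (basisv i) w)))).
move=> t; rewrite (linear_sumE (lfun_linear _)) {1}(tens_sum t) (linear_sumE (lfun_linear _)).
apply: eq_bigr => i _; rewrite tens_canonE linfunE //.
exact: (linear_comp (lfun_linear F) (pure_linr _)).
Qed.

(** The forms that are nonnegative on [max_tens C D] are those of
    [min_tens (dual_cone C) (dual_cone D)], not just of its closure: this is
    where closedness of minimal tensor products of arbitrary closed cones
    enters, and it is what makes the sum finite. *)
Lemma max_tens_dual V W (C : set V) (D : set W) (F : dualv (tensv V W)) :
  dual_cone (max_tens C D) F ->
  exists n (phi : 'I_n -> dualv V) (psi : 'I_n -> dualv W),
    [/\ forall i, dual_cone C (phi i), forall i, dual_cone D (psi i) &
        forall t, F t = \sum_i psi i (t (phi i))].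
Proof.
move=> posF; have [q qF] := tens_canon_functional F.
suff [n [phi [psi [Cphi Dpsi E]]]] : min_tens (dual_cone C) (dual_cone D) q.
  exists n, phi, psi; split=> // t; rewrite qF E (linear_sumE (lfun_linear _)).
  by apply: eq_bigr => i _; rewrite tens_canonE.
apply: bipolar; first exact: min_tens_closed (dual_cone_closed _) (dual_cone_closed _).
by move=> theta ptheta; have [t tE] := tens_canon_surj theta; rewrite -tE -qF;
  apply: posF; rewrite /max_tens /= tE.
Qed.

End TensorCones.

(** * The cones of a stem *)

(* The bare name denotes the type of linear maps at this point. *)
Local Notation hom := Defs.hom.

Section Stem.
Variables (R : realType) (C : starAut) (S : stem R C).
Implicit Types (X : vectType R) (c d e : C).

Lemma smap_comp c d e (g : hom d e) (f : hom c d) v :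
  smap S (g \o f)%cat v = smap S g (smap S f v).
Proof.
have -> : smap S (g \o f)%cat = (smap S g \o smap S f)%VF := Defs.fmap_comp S g f.
by rewrite comp_lfunE.
Qed.

Lemma smap_id c v : smap S (idm c) v = v.
Proof.
have -> : smap S (idm c) = \1%VF := Defs.fmap_id S c.
by rewrite id_lfunE.
Qed.

Definition sval_form : dualv (sob S (dual unitob)) :=
  linfun (fun v => sval_unit_dual v : R^o).

Lemma sval_formE v : sval_form v = sval_unit_dual v.
Proof. by rewrite linfunE // => k x y; rewrite /sval_unit_dual linearP addvE scalevE. Qed.

Definition Aform c (f : hom c (dual unitob)) : dualv (sob S c) :=
  dualfun (smap S f) sval_form.

Lemma AformE c (f : hom c (dual unitob)) v :
  Aform f v = sval_unit_dual (smap S f v).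
Proof. by rewrite dualfunE sval_formE. Qed.

Lemma Aform_dual c (f : hom c (dual unitob)) : dual_cone (Acone S c) (Aform f).
Proof. by move=> v Av; rewrite AformE. Qed.

Lemma Acone_dual c (v : sob S c) :
  (forall psi, dual_cone (Acone S c) psi -> 0 <= (psi v : R)) -> Acone S c v.
Proof. by move=> h f; rewrite -AformE; apply: h; exact: Aform_dual. Qed.

Lemma Acone_hom c d (f : hom c d) v : Acone S c v -> Acone S d (smap S f v).
Proof. by move=> Av g; rewrite -smap_comp. Qed.

Lemma Acone_closed c : closed_convex_cone (Acone S c).
Proof.
have -> : Acone S c = [set v | forall psi, range (@Aform c) psi -> 0 <= (psi v : R)].
  apply/seteqP; split=> [v Av _ [f _ <-]|v Av f]; first by rewrite AformE.
  by rewrite -AformE; apply: Av; exists f.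
exact: halfspaces_closed.
Qed.

Lemma Bcone_hom c d (f : hom c d) v : Bcone S c v -> Bcone S d (smap S f v).
Proof.
move: v; apply: closed_cone_hull_min.
  apply: (preimage_closed_cone (smap S f)); exact: closed_cone_hull_closed.
move=> _ [g _ <-] /=; rewrite -smap_comp; apply: sub_closed_cone_hull.
by exists (f \o g)%cat.
Qed.

Lemma Bcone_unit : Bcone S unitob (seta S 1).
Proof.
by apply: sub_closed_cone_hull; exists (idm unitob) => //; rewrite smap_id.
Qed.

Lemma min_system_is_system X (D : set X) :
  closed_convex_cone D -> is_system (min_system S D).
Proof.
move=> cD; split=> [c|c d f _ [t [n [x [b [Dx Bb ->]]]] <-]].
  exact: (min_tens_closed cD (closed_cone_hull_closed _)).
exists n, x, (fun i => smap S f (b i)); split=> // [i|]; first exact: Bcone_hom.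
rewrite (linear_sumE (lfun_linear _)); apply: eq_bigr => i _.
by rewrite tensfun_pure id_lfunE.
Qed.

(** * Finite generation of the smallest system over a cone *)

(** The generators are [v (x) 1] at the unit, for [v] in a finite generating set
    of [D]: applying a morphism [1 -> c] turns [1] into a generator of [B(c)],
    and the levels of a system are closed convex cones. *)
Lemma polyhedral_finitely_generated X (D : set X) :
  closed_convex_cone D -> polyhedral D -> finitely_generated (min_system S D).
Proof.
move=> cD [A /finite_seqP [s ->] DE].
exists (size s), (fun=> unitob), (fun i => pure (s`_i) (seta S 1)).
split; first exact: min_system_is_system.
  move=> i; apply: min_tens_pure; last exact: Bcone_unit.
  by rewrite DE; apply: sub_cone_hull; exact: mem_nth.
move=> H [cH Hhom] Ha c _ [n [x [b [Dx Bb ->]]]].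
apply: convex_cone_sum => [|i _]; first by have [] := cH c.
have pl (y : X) : linfun (fun w : sob S c => pure y w) =1 pure y.
  by apply: linfunE; exact: pure_linr.
have pr (w : sob S c) : linfun (fun y : X => pure y w) =1 (fun y => pure y w).
  by apply: linfunE; exact: pure_linl.
rewrite -pr; move: (x i) (Dx i); rewrite DE; apply: cone_hull_min.
  by have [] := preimage_closed_cone (linfun (fun y : X => pure y (b i))) (cH c).
move=> _ /= /(nthP 0) [j js <-]; rewrite pr -pl.
move: (b i) (Bb i); apply: closed_cone_hull_min; first exact: preimage_closed_cone.
move=> _ [f _ <-] /=; rewrite pl; apply: (Hhom _ _ f).
exists (pure s`_j (seta S 1)); last by rewrite tensfun_pure id_lfunE.
exact: (Ha (Ordinal js)).
Qed.

Lemma min_tensS X (V : vectType R) (D D' : set X) (B : set V) :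
  D `<=` D' -> min_tens D B `<=` min_tens D' B.
Proof. by move=> DD' _ [n [x [b [Dx Bb ->]]]]; exists n, x, b; split=> // i; exact: DD'. Qed.

Definition setai : 'Hom(sob S unitob, R^o) := bwd (Defs.eta S).

Lemma setaK r : setai (seta S r) = r.
Proof.
have E : (setai \o seta S)%VF = \1%VF := fwdK (Defs.eta S).
by rewrite -comp_lfunE E id_lfunE.
Qed.

(** Each generator is a finite sum of pure tensors. Let [D0] be the cone
    generated by all their first factors, a polyhedral subcone of [D]. The
    system of [D0] contains the generators, hence that of [D]; at the unit,
    where [B] is a half-line, this says that [D] is contained in [D0]. *)
Lemma finitely_generated_polyhedral X (D : set X) :
  Bcone S unitob = seta S @` [set r | (0 : R) <= r] ->
  closed_convex_cone D -> finitely_generated (min_system S D) -> polyhedral D.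
Proof.
move=> hB cD [n [c [a [_ Ga Gmin]]]].
have /choice [s sP] i : exists s : seq X, (forall x, x \in s -> D x) /\
    min_tens (cone_hull [set` s]) (Bcone S (c i)) (a i).
  have [m [x [b [Dx Bb ->]]]] := Ga i.
  exists [seq x j | j <- enum 'I_m]; split=> [_ /mapP [j _ ->] //|].
  exists m, x, b; split=> // j; apply: sub_cone_hull => /=.
  by apply: map_f; rewrite mem_enum.
pose s0 := flatten [seq s i | i <- enum 'I_n].
exists [set` s0]; first by apply/finite_seqP; eexists.
apply/seteqP; split=> x; last first.
  apply: cone_hull_min; first by have [] := cD.
  by move=> y /= /flatten_mapP [i _ /(sP i).1].
move=> Dx; have := Gmin (min_system S (cone_hull [set` s0]))
  (min_system_is_system (finite_cone_closed s0)) _ unitob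
  _ (min_tens_pure Dx Bcone_unit).
case=> [i|m [y [b [Hy Bb E]]]].
  apply: min_tensS (sP i).2; apply: cone_hullS => y sy /=.
  by apply/flatten_mapP; exists i; rewrite ?mem_enum.
have -> : x = \sum_j (setai (b j) : R) *: y j.
  have := congr1 (fun t => trunit X (tensfun \1%VF setai t)) E.
  rewrite !(linear_sumE (lfun_linear _)) tensfun_pure trunit_pure setaK id_lfunE.
  rewrite scale1r => ->; apply: eq_bigr => j _.
  by rewrite tensfun_pure trunit_pure id_lfunE.
have [_ _ HZ] := cone_hull_convex [set` s0].
apply: convex_cone_sum => [|j _]; first exact: cone_hull_convex.
by apply: HZ => //; have := Bb j; rewrite hB => -[r r0 <-]; rewrite setaK.
Qed.

(** * Concrete realizations of the largest system over a cone *)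

Lemma dualfun1 (V : vectType R) (phi : dualv V) : dualfun \1%VF phi = phi.
Proof. by apply/lfunP => v; rewrite dualfunE id_lfunE. Qed.

Lemma tensfun_evE X c d (f : hom c d) (t : tensv X (sob S c)) phi :
  tensfun \1%VF (smap S f) t phi = smap S f (t phi).
Proof. by rewrite tensfunE dualfun1. Qed.

Lemma Acone_iso c d (f : catiso c d) v :
  Acone S d (smap S f v) <-> Acone S c v.
Proof.
split=> [|/Acone_hom]; last exact.
by move=> /(Acone_hom (bwd f)); rewrite -smap_comp fwdK smap_id.
Qed.

(** The map [X -> S 1] by which a linear form on [X] is concretely realized. *)
Definition unit_form X (phi : dualv X) : 'Hom(X, sob S unitob) := (seta S \o phi)%VF.

Lemma unit_form_realization X (phi : dualv X) c (t : tensv X (sob S c)) :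
  smap S (lunit c) (smu S unitob c (tensfun (unit_form phi) \1%VF t)) = t phi.
Proof.
have E : (smap S (lunit c) \o (smu S unitob c \o tensfun (seta S) \1%VF))%VF =
  tlunit (sob S c) := mu_lunit S c.
rewrite (tens_sum t) !(linear_sumE (lfun_linear _)) sum_lfunE.
apply: eq_bigr => i _; rewrite pureE -tlunit_pure -E !comp_lfunE !tensfun_pure.
by rewrite comp_lfunE.
Qed.

(** By Farkas' lemma only the forms in [s] have to be tested against the first
    factor. *)
Lemma hcone_max_system X (s : seq (dualv X)) c t :
  max_system S (hcone s) c t <-> forall phi, phi \in s -> Acone S c (t phi).
Proof.
rewrite /max_system max_tensP; split=> [h phi sphi|h phi psi].
  apply: Acone_dual => psi Apsi; apply: h => // x; exact.
rewrite dual_hcone => Hphi Apsi; move: phi Hphi; apply: cone_hull_min; last first.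
  by move=> phi /h; exact: Apsi.
split=> [|f g|k f k0] /=.
- by rewrite !linear0.
- by rewrite !linearD; exact: addr_ge0.
- by rewrite !linearZ; exact: mulr_ge0.
Qed.

Lemma polyhedral_hedron X (D : set X) :
  polyhedral D -> is_hedron (max_system S D).
Proof.
move=> /polyhedral_hcone [s ->].
exists (size s), (fun (i : 'I_(size s)) c (t : tensv X (sob S c)) => Acone S c (t s`_i)).
split=> [i|c]; last first.
  apply/seteqP; split=> t /=.
    by move=> /hcone_max_system h i _; apply: h; exact: mem_nth.
  by move=> h; apply/hcone_max_system => _ /(nthP 0) [j js <-]; exact: (h (Ordinal js)).
split; last first.
  exists unitob, (unit_form s`_i) => c; apply/seteqP; split=> t;
    by rewrite /= /intrinsic /= -(Acone_iso (lunit c)) unit_form_realization.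
split=> [c|c d f _ [t At <-]]; last by rewrite tensfun_evE; exact: Acone_hom.
have lin : linear (fun t : tensv X (sob S c) => t s`_i).
  by move=> k x y; rewrite addvE scalevE.
have := preimage_closed_cone (linfun (fun t : tensv X (sob S c) => t s`_i)) (Acone_closed c).
by congr closed_convex_cone; apply/seteqP; split=> t /=; rewrite linfunE.
Qed.

(** The functor [c |-> hom (d (x) c) 1^*] is representable: braid [d] to the right
    and transpose. This takes place in [C]; the stem is only applied to the
    resulting factorisation, in which the order [d (x) c] is the original one. *)
Lemma pairing_universal d : exists e (u : hom (tens d e) (dual unitob)),
  forall c (f : hom (tens d c) (dual unitob)),
    exists h : hom c e, f = (u \o tensm (idm d) h)%cat.
Proof.
have [g gK Kg] := transp_bij (dual (tens d (dual (dual unitob)))) d (dual (@unitob C)).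
exists (dual (tens d (dual (dual unitob)))), (g (idm _) \o braid _ _)%cat => c f.
pose h := transp (f \o braid c d)%cat; exists h.
have E : (f \o braid c d)%cat = (g (idm _) \o tensm h (idm d))%cat.
  by apply: (bij_inj (transp_bij c d _)); rewrite transp_nat1 Kg compm_idl.
by rewrite -compmA braid_nat compmA -E -compmA symmetry compm_idr.
Qed.

Lemma smu_nat X d c e (Psi : 'Hom(X, sob S d)) (h : hom c e) (t : tensv X (sob S c)) :
  smap S (tensm (idm d) h) (smu S d c (tensfun Psi \1%VF t)) =
  smu S d e (tensfun Psi \1%VF (tensfun \1%VF (smap S h) t)).
Proof.
have E : (smu S d e \o tensfun (smap S (idm d)) (smap S h))%VF =
  (smap S (tensm (idm d) h) \o smu S d c)%VF := mu_nat S (idm d) h.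
rewrite -comp_lfunE -E comp_lfunE; congr (smu S d e _).
have -> : smap S (idm d) = \1%VF := Defs.fmap_id S d.
by apply/lfunP => phi; rewrite !tensfunE !id_lfunE !dualfun1.
Qed.

Lemma max_tensS X (V : vectType R) (D D' : set X) (A : set V) :
  D `<=` D' -> max_tens D A `<=` max_tens D' A.
Proof.
move=> DD' t /max_tensP h; apply/max_tensP => phi psi D'phi.
by apply: h => x /DD'; exact: D'phi.
Qed.

(** All the inequalities that define the realization by [Psi] are pulled back
    along morphisms [c -> e] from the single one given by the universal
    pairing [u : d (x) e -> 1^*]. As a form on [X (x) S e], this one is nonnegative
    on the system of [D], hence a finite sum of products of a form in the dual
    of [D] and one in the dual of [A(e)]. The first factors make up [s]: the
    pullbacks are then nonnegative on the system of [hcone s]. *)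
Lemma realization_bound X (D : set X) (H : Defs.family S X) :
  has_concrete_realization H ->
  (forall c, max_system S D c `<=` H c) ->
  exists s : seq (dualv X), (forall phi, phi \in s -> dual_cone D phi) /\
    forall c, max_system S (hcone s) c `<=` H c.
Proof.
move=> [d [Psi HE]] DH; have [e [u uP]] := pairing_universal d.
pose F : dualv (tensv X (sob S e)) :=
  dualfun (smu S d e \o tensfun Psi \1%VF)%VF (Aform u).
have FE t : F t = sval_unit_dual (smap S u (smu S d e (tensfun Psi \1%VF t))).
  by rewrite dualfunE AformE comp_lfunE.
have [|n [phi [psi [Dphi Apsi Fsum]]]] := @max_tens_dual _ _ _ D (Acone S e) F.
  by move=> t /DH; rewrite HE FE; apply.
exists [seq phi i | i <- enum 'I_n]; split=> [_ /mapP [i _ ->] //|c t /max_tensP ht].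
rewrite HE => f; have [h ->] := uP c f.
rewrite smap_comp smu_nat -FE Fsum; apply: sumr_ge0 => i _.
rewrite tensfun_evE -dualfunE; apply: ht.
  by move=> x; apply; apply: map_f; rewrite mem_enum.
by move=> v Av; rewrite dualfunE; apply: Apsi; exact: Acone_hom.
Qed.

(** Endomorphisms of [1^*] are duals of endomorphisms of [1], hence act on the
    line [S 1^*] as the scalars by which the latter act on [S 1]; these are
    nonnegative by the hypothesis on [B]. *)
Lemma dual_unit_ray : Bcone S unitob = seta S @` [set r | (0 : R) <= r] ->
  exists2 w, Acone S (dual unitob) w & sval_unit_dual w = 1.
Proof.
move=> hB; pose w := (bwd (Defs.delta S unitob) : 'Hom(_, _)) (setai : dualv (sob S unitob)).
have dw : sdelta S unitob w = setai.
  have E : (sdelta S unitob \o (bwd (Defs.delta S unitob) : 'Hom(_, _)))%VF = \1%VF :=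
    bwdK (Defs.delta S unitob).
  by rewrite -comp_lfunE E id_lfunE.
exists w; last by rewrite /sval_unit_dual dw setaK.
move=> f; have [g <-] := dualm_full f.
have E : (sdelta S unitob \o smap S (dualm g))%VF =
  (dualfun (smap S g) \o sdelta S unitob)%VF := delta_nat S g.
rewrite /sval_unit_dual -comp_lfunE E comp_lfunE dw dualfunE.
have := @Bcone_hom _ _ g _ Bcone_unit; rewrite hB => -[r r0 <-].
by rewrite setaK.
Qed.

(** Collecting the forms of all realizations gives a polyhedral cone containing
    [D] whose largest system is contained in that of [D]. Evaluating both at
    [1^*], on tensors [x (x) w] with a fixed nonzero [w] in [A 1^*], shows that the
    two cones agree. *)
Lemma hedron_polyhedral X (D : set X) :
  Bcone S unitob = seta S @` [set r | (0 : R) <= r] ->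
  closed_convex_cone D -> is_hedron (max_system S D) -> polyhedral D.
Proof.
move=> hB cD [n [H [HP GE]]].
have sub i c : max_system S D c `<=` H i c by rewrite GE => t; apply.
have /choice [s sP] i := realization_bound (HP i).2 (sub i).
pose s0 := flatten [seq s i | i <- enum 'I_n].
apply/polyhedral_hcone; exists s0; apply/seteqP; split=> x.
  by move=> Dx phi /flatten_mapP [i _ /(sP i).1]; apply.
move=> s0x; have [w Aw w1] := dual_unit_ray hB.
have xw : max_system S (hcone s0) (dual unitob) (pure x w).
  apply/max_tensP => phi psi s0phi Apsi; rewrite pureE linearZ.
  by apply: mulr_ge0; [exact: s0phi | exact: Apsi].
have /max_tensP Dxw : max_system S D (dual unitob) (pure x w).
  rewrite GE => i _; apply: (sP i).2; apply: max_tensS xw => y s0y phi sphi.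
  by apply: s0y; apply/flatten_mapP; exists i; rewrite ?mem_enum.
apply: bipolar => // phi Dphi.
have := Dxw phi (Aform (idm _)) Dphi (@Aform_dual _ _).
by rewrite pureE linearZ /= AformE smap_id w1 /GRing.scale /= mulr1.
Qed.

End Stem.

Theorem theorem3p27 (R : realType) (C : starAut) (S : stem R C)
    (hB : Bcone S unitob = seta S @` [set r | (0 : R) <= r])
    (X : vectType R) (D : set X) (hD : closed_convex_cone D) :
  (is_hedron (max_system S D) <-> finitely_generated (min_system S D)) /\
  (finitely_generated (min_system S D) <-> polyhedral D).
Proof.
have fp : finitely_generated (min_system S D) <-> polyhedral D.
  split; first exact: finitely_generated_polyhedral.
  exact: polyhedral_finitely_generated.
split=> //; rewrite fp; split; last exact: polyhedral_hedron.
exact: hedron_polyhedral.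
Qed.
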